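(* Let $p\ge 3$ be a prime and $k$ a positive integer with $p\nmid k$, and let $\phi_{(p,k)}(x)=x^p+kpx^{p-1}-kp\in\mathbb{Z}[x]$. Suppose that the critical point $a=-k(p-1)$ of $\phi_{(p,k)}$ has infinite forward orbit under $\phi_{(p,k)}$. Then $G_{\mathbb{Q}}(\phi_{(p,k)})$ has finite index in $\mathrm{Aut}(T_\infty)$.
   Context: For a number field $K$ and $\varphi\in K[x]$ of degree $d\ge 2$ such that every iterate $\varphi^n$ ($n\ge1$) is separable, the pre-image tree $T_\infty$ has vertex set $\bigsqcup_{n\ge 0}\varphi^{-n}(0)$ (with $\varphi^{-0}(0)=\{0\}$), and $\alpha\in\varphi^{-n}(0)$, $\beta\in\varphi^{-(n+1)}(0)$ are joined by an edge iff $\varphi(\beta)=\alpha$. $\mathrm{Aut}(T_\infty)$ is its graph automorphism group. $\mathrm{Gal}(\overline{K}/K)$ acts on $T_\infty$ through its action on the sets $\varphi^{-n}(0)$, giving $\rho:\mathrm{Gal}(\overline K/K)\to\mathrm{Aut}(T_\infty)$; $G_K(\varphi)$ denotes its image. *)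

(* Defs.v *)
(* Qbar is modelled by algC (algebraic closure of Q). *)
From HB Require Import structures.
From mathcomp Require Import all_boot all_order all_algebra all_field.
Set Implicit Arguments. Unset Strict Implicit. Unset Printing Implicit Defensive.
Import Order.TTheory GRing.Theory Num.Theory.
Local Open Scope ring_scope.

Definition phi_pk (p k : nat) : {poly algC} :=
  'X^p + ((k * p)%N%:R) *: 'X^(p.-1) - ((k * p)%N%:R)%:P.

Definition fiter (f : {poly algC}) (n : nat) (x : algC) : algC :=
  iter n (fun y => f.[y]) x.

(* Vertices of the pre-image tree: the disjoint union over n of f^{-n}(0),
   a vertex being a level n together with a point x with f^n(x) = 0. *)
Record vertex (f : {poly algC}) := Vertex {
  lvl : nat;
  pt : algC;
  ptP : fiter f lvl pt == 0 }.

Definition tree_edge (f : {poly algC}) (u v : vertex f) : Prop :=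
  (lvl v = (lvl u).+1 /\ f.[pt v] = pt u) \/
  (lvl u = (lvl v).+1 /\ f.[pt u] = pt v).

Definition is_tree_aut (f : {poly algC}) (t : vertex f -> vertex f) : Prop :=
  bijective t /\ forall u v, tree_edge u v <-> tree_edge (t u) (t v).

(* t lies in G_Q(f) = rho(Gal(Qbar/Q)): t is the action of some field
   automorphism sigma of Qbar = algC on the tree. *)
Definition is_galois_image (f : {poly algC}) (t : vertex f -> vertex f) : Prop :=
  exists sigma : {rmorphism algC -> algC},
    bijective sigma /\
    forall v, lvl (t v) = lvl v /\ pt (t v) = sigma (pt v).

Definition finite_index_in_aut (f : {poly algC}) : Prop :=
  exists (m : nat) (g : 'I_m -> (vertex f -> vertex f)),
    (forall i, is_tree_aut (g i)) /\
    forall t, is_tree_aut t ->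
      exists i, exists h, is_galois_image h /\ forall v, t v = g i (h v).

(* Main.v *)
Require Import Defs.
From HB Require Import structures.
From mathcomp Require Import all_boot all_order all_algebra all_field.
From mathcomp Require Import boolp classical_sets filter ring zify.
Set Implicit Arguments. Unset Strict Implicit. Unset Printing Implicit Defensive.
Import Order.TTheory GRing.Theory Num.Theory.
Local Open Scope ring_scope.

(** The Galois action is in fact all of Aut(T_oo), hence of index 1. The
    critical point 0 satisfies 0 -> -kp -> -kp, and the orbit of the other one
    is phi^n(a) = k c_n with c_n + p = w_n^2, where
    w_1 = (k(p-1))^((p-1)/2) and w_(n+1) = (k c_n)^((p-1)/2) w_n. Thus c_n is a
    square only if p = 3 and k = 1, when a has a finite orbit, and otherwise
    some prime q divides c_n to an odd power. It does not divide kp nor any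
    c_i with i < n, so modulo a prime M over q the roots of phi^n are distinct,
    except for one pair r, s lying over a.

    Inertia supplies the transposition (r s): if no automorphism acts on the
    roots in this way, then every element sigma <> 1 of the Galois group moves
    some root u modulo M. Expanding x * prod_(sigma <> 1) (u_sigma - sigma u_sigma)
    as a combination of traces then shows that q is a uniformizer at M, so the
    M-adic valuation of (a - r)(a - s) ~ k c_n is a sum i + j of integers, and
    phi'(a) = 0 forces i = j, against the parity of the q-adic valuation of c_n.

    As phi^n is Eisenstein at p, the classes of the relation "(x y) is realized
    by an automorphism" inside a fibre of phi have the same size everywhere;
    this size is at least 2 and divides p, so all transpositions within fibres
    are realized, hence by induction all automorphisms of the truncated
    trees. An ultrafilter limit handles all levels at once. *)

Local Notation pQtoC := (map_poly (ratr : rat -> algC)).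
Local Notation pZtoC := (map_poly (intr : int -> algC)).
Local Notation pZtoQ := (map_poly (intr : int -> rat)).

(** * Number fields and conjugates *)

(** The roots generate a splitting field of [f], and [f] is separable because [rs] has no
    repetition; hence the extension is Galois. *)
Lemma splitting_num_field (f : {poly rat}) (rs : seq algC) :
  pQtoC f = \prod_(r <- rs) ('X - r%:P) -> uniq rs ->
  exists (L : splittingFieldType rat) (i : {rmorphism L -> algC}) (s : seq L),
    [/\ galois 1 {:L}, map i s = rs & <<1 & s>>%VS = fullv].
Proof.
move=> Df Urs; have [L [i [s Ds genL]]] := num_field_exists rs.
pose g := map_poly (in_alg L) f.
have Eg : map_poly i g = pQtoC f.
  rewrite -map_poly_comp; apply: eq_map_poly => a /=.
  by rewrite rmorphZ_num rmorph1 mulr1.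
have Dg : g = \prod_(z <- s) ('X - z%:P).
  apply: (map_inj_poly (fmorph_inj i) (rmorph0 i)).
  rewrite Eg Df -Ds big_map rmorph_prod /=; apply: eq_bigr => z _.
  by rewrite map_polyXsubC.
have g1 : g \is a polyOver 1%AS by apply/polyOver1P; exists f.
have splitg : splittingFieldFor 1 g {:L} by exists s; rewrite // -Dg eqpxx.
have ax : FieldExt_isSplittingField _ L by constructor; exists g.
pose L' : splittingFieldType rat := HB.pack_for (splittingFieldType rat) L ax.
exists L', i, s; split=> //; apply/splitting_galoisField.
exists g; split=> //; rewrite Dg separable_prod_XsubC.
by rewrite -(map_inj_uniq (fmorph_inj i)) Ds.
Qed.

(* K is the field generated by rs, and the nu i extend the elements of its
   Galois group to algC, nu i0 extending the identity. *)
Lemma galois_transversal (f : {poly rat}) (rs : seq algC) :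
  pQtoC f = \prod_(r <- rs) ('X - r%:P) -> uniq rs ->
  exists (I : finType) (nu : I -> {rmorphism algC -> algC}) (i0 : I)
         (K : algC -> Prop),
    [/\ [/\ {in rs, forall x, K x}, forall a : rat, K (ratr a),
            forall x y, K x -> K y -> K (x - y),
            forall x y, K x -> K y -> K (x * y)
          & forall i x, K x -> K (nu i x)],
        forall x, K x -> nu i0 x = x,
        forall i, i != i0 -> exists2 x, x \in rs & nu i x != x
      & forall x, K x -> \sum_i nu i x \in Crat].
Proof.
move=> Df Urs; have [L [j [s [galL Ds genL]]]] := splitting_num_field Df Urs.
pose nu (g : gal_of {:L}) := sval (extend_algC_subfield_aut j g).
have nuE g x : nu g (j x) = j (g x).
  by rewrite /nu; case: extend_algC_subfield_aut => h /= ->.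
exists (gal_of {:L}), nu, 1%g, (fun x => exists y, x = j y).
split=> [|x [y ->]|g ng1|_ [y ->]].
- split=> [x|a|_ _ [x ->] [y ->]|_ _ [x ->] [y ->]|g _ [y ->]].
  + by rewrite -Ds => /mapP[y _ ->]; exists y.
  + by exists (ratr a); rewrite fmorph_rat.
  + by exists (x - y); rewrite rmorphB.
  + by exists (x * y); rewrite rmorphM.
  + by exists (g y); rewrite nuE.
- by rewrite nuE gal_id.
(* An automorphism fixing all the roots fixes the field they generate, which is all of [L]. *)
- apply/hasP/negbNE/negP=> /hasPn fix_g; case/eqP: ng1; apply/eqP/gal_eqP=> x _.
  rewrite gal_id; apply/fixedSpaceP.
  suff /subvP-> : (<<1 & s>> <= fixedSpace g)%VS by rewrite ?genL ?memvf.
  apply/Fadjoin_seqP; split; first exact: sub1v.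
  move=> y sy; apply/fixedSpaceP; apply: (fmorph_inj j); rewrite -nuE.
  by apply/eqP/negbNE/fix_g; rewrite -Ds map_f.
- under eq_bigr do rewrite nuE.
  rewrite -rmorph_sum /=.
  have G1 (g : gal_of {:L}) : (g \in 'Gal({:L} / 1)%g) = true.
    by rewrite gal_kHom ?sub1v ?k1AHom.
  have := mem_galTrace galL (memvf y); rewrite /galTrace (eq_bigl _ _ G1).
  by case/vlineP=> a ->; rewrite alg_num_field fmorph_rat Crat_rat.
Qed.

(** Otherwise the gcd of [f] and its derivative, a nonconstant divisor of the irreducible [f], would
    be associate to [f], so [f] would divide its derivative, which is nonzero and of smaller
    degree. *)
Lemma irreducible_split_uniq (f : {poly rat}) :
  f \is monic -> irreducible_poly f ->
  exists2 rs, pQtoC f = \prod_(r <- rs) ('X - r%:P) & uniq rs.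
Proof.
move=> mf irf; have [rs Df] := closed_field_poly_normal (pQtoC f).
have {}Df : pQtoC f = \prod_(r <- rs) ('X - r%:P).
  by rewrite Df lead_coef_map (monicP mf) rmorph1 scale1r.
exists rs => //; rewrite -separable_prod_XsubC -Df separable_map.
have [szf dvf] := irf; rewrite unlock; apply/negPn/negP=> ncop.
have dvd_f : f %| f^`().
  by rewrite -(eqp_dvdl _ (dvf _ ncop (dvdp_gcdl _ _))) dvdp_gcdr.
have nzf' : f^`() != 0.
  apply/eqP=> /(congr1 (fun g : {poly rat} => g`_(size f).-2)) /eqP.
  have Dsz : (size f).-2.+1 = (size f).-1 by case: (size f) szf => [|[]].
  by rewrite coef_deriv coef0 mulrn_eq0 eqE /= Dsz -lead_coefE (monicP mf) oner_eq0.
by have := dvdp_leq nzf' dvd_f; rewrite leqNgt lt_size_deriv // monic_neq0.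
Qed.

(** [f] is associate to the minimal polynomial of [x], so normality of the splitting field gives a
    Galois element taking [x] to [y], and this extends to [algC]. *)
Lemma irreducible_conjugates (f : {poly rat}) (x y : algC) :
  f \is monic -> irreducible_poly f -> root (pQtoC f) x -> root (pQtoC f) y ->
  exists nu : {rmorphism algC -> algC}, nu x = y.
Proof.
move=> mf irf fx0 fy0; have [rs Df Urs] := irreducible_split_uniq mf irf.
have [L [j [s [galL Ds genL]]]] := splitting_num_field Df Urs.
have inj z : root (pQtoC f) z -> exists z1, z = j z1.
  by rewrite Df root_prod_XsubC -Ds => /mapP[z1 _ ->]; exists z1.
have [x1 Dx] := inj x fx0; have [y1 Dy] := inj y fy0.
have /polyOver1P[g Dg] := minPolyOver 1 x1.
have Eg z1 : root (minPoly 1 x1) z1 = root (pQtoC g) (j z1).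
  rewrite -(fmorph_root j) Dg -map_poly_comp; congr (root _ _).
  by apply: eq_map_poly => a /=; rewrite rmorphZ_num rmorph1 mulr1.
have dvd_fg : f %| g.
  have [r [Dr mr] dv_r] := minCpolyP x.
  have dvd_rf : r %| f by rewrite -dv_r.
  have szr : size r != 1 by
    rewrite neq_ltn -(size_map_poly (ratr : {rmorphism rat -> algC})) -Dr size_minCpoly orbT.
  rewrite -(eqp_dvdl _ (irf.2 _ szr dvd_rf)) -dv_r Dx -Eg.
  exact: root_minPoly.
have : root (minPoly 1 x1) y1.
  rewrite Eg -Dy; case/dvdpP: dvd_fg => h ->.
  by rewrite rmorphM rootM fy0 orbT.
case/and3P: (galL) => _ _ nrm.
case/(normalField_root_minPoly (sub1v _) nrm (memvf _)) => g' _ Dg'.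
have [nu Dnu] := extend_algC_subfield_aut j g'.
by exists nu; rewrite Dx Dy -Dnu -Dg'.
Qed.

(** * Prime ideals of the ring of algebraic integers *)

(** The ideal lives in the ring of all algebraic integers, so that the same [M] can be used for the
    roots of every level. *)
Record Aint_prime (q : nat) (M : set algC) : Prop := AintPrime {
  AP_prime : prime q;
  AP_Aint : forall x, M x -> x \in Aint;
  AP_B : forall x y, M x -> M y -> M (x - y);
  AP_Ml : forall x y, x \in Aint -> M y -> M (x * y);
  AP_char : M q%:R;
  AP_1 : ~ M 1;
  AP_M : forall x y, x \in Aint -> y \in Aint -> M (x * y) -> M x \/ M y }.

(* The sets of the Zorn argument may be empty, so that the empty chain is covered. *)
Lemma Aint_prime_exists q : prime q -> exists M, Aint_prime q M.
Proof.
move=> pr_q; have qA : q%:R \in Aint by rewrite rpred_nat.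
(* [q] is not a unit, as 1/q is not an algebraic integer. *)
have q_unit (y : algC) : y \in Aint -> q%:R * y <> 1.
  move=> Ay Dy; have := eqAmod0_nat q 1.
  rewrite dvdn1 eqn_leq leqNgt prime_gt1 // eqAmod0 unfold_in /= pnatr_eq0.
  have nq0 : (q == 0%N) = false by apply/eqP=> q0; rewrite q0 in pr_q.
  have nz_q : q%:R != 0 :> algC by rewrite pnatr_eq0 nq0.
  rewrite nq0 /= (_ : _ / _ = y) ?Ay //.
  by apply: (canLR (mulfK nz_q)); rewrite mulrC Dy.
(* The last clause says that [A] and [q] together do not generate 1; a maximal such [A] turns out to
   contain [q]. *)
pose P (A : set algC) := [/\ forall x, A x -> x \in Aint,
  forall x y, A x -> A y -> A (x - y),
  forall x y, x \in Aint -> A y -> A (x * y)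
  & forall x y, A x -> y \in Aint -> x + q%:R * y <> 1].
have [F FP Ftot | A [[AA AB AM A1] Amax]] := @Zorn_bigcup _ P.
  split=> [x [A FA Ax]|x y [A FA Ax] [B FB By]|x y Ax [A FA Ay]|x y [A FA Ax]].
  - by have [h _ _ _] := FP A FA; apply: h.
  - have [sAB|sBA] := Ftot A B FA FB.
      exists B => //; have [_ h _ _] := FP B FB; apply: h => //; exact: sAB.
    exists A => //; have [_ h _ _] := FP A FA; apply: h => //; exact: sBA.
  - by exists A => //; have [_ _ h _] := FP A FA; apply: h.
  - by have [_ _ _ h] := FP A FA; apply: h.
have A0 : A 0.
  apply: contrapT => nA0.
  pose B : set algC := fun x => exists2 y, y \in Aint & x = q%:R * y.
  apply: (Amax B).
    split=> [x Ax|/(_ 0)]; first by case: nA0; rewrite -(subrr x); apply: AB.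
    by move=> h; apply/nA0/h; exists 0; rewrite ?rpred0 ?mulr0.
  split=> [_ [y Ay ->]|_ _ [x Ax ->] [y Ay ->]|x _ Ax [y Ay ->]|_ y [x Ax ->] Ay].
  - by rewrite rpredM.
  - by exists (x - y); rewrite ?rpredB // mulrBr.
  - by exists (x * y); rewrite ?rpredM // mulrCA.
  - by rewrite -mulrDr; apply: q_unit; rewrite rpredD.
have AD x y : A x -> A y -> A (x + y).
  by move=> Ax Ay; rewrite -[y]opprK; apply: (AB) => //; rewrite -[- y]sub0r; apply: AB.
(* By maximality, adjoining an element outside [A] makes 1 reachable with the help of [q]. *)
have step x : x \in Aint ->
    A x \/ exists a y z, [/\ A a, y \in Aint, z \in Aint & a + x * y + q%:R * z = 1].
  move=> Ax; case: (pselect (A x)) => [|nAx]; [by left | right].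
  apply: contrapT => no.
  pose B : set algC := fun z => exists a y, [/\ A a, y \in Aint & z = a + x * y].
  apply: (Amax B).
    split=> [z Az|/(_ x) h]; first by exists z, 0; rewrite rpred0 mulr0 addr0.
    by apply/nAx/h; exists 0, 1; rewrite rpred1 mulr1 add0r.
  split=> [_ [a [y [Aa Ay ->]]]|_ _ [a [y [Aa Ay ->]]] [b [z [Ab Az ->]]]
          |c _ Ac [a [y [Aa Ay ->]]]|_ z [a [y [Aa Ay ->]]] Az e].
  - by apply: rpredD; [apply: AA | apply: rpredM].
  - by exists (a - b), (y - z); split; [apply: AB | rewrite rpredB | ring].
  - by exists (c * a), (c * y); split; [apply: AM | rewrite rpredM | ring].
  - by case: no; exists a, y, z.
have Aq : A q%:R.
  have [//|[a [y [z [Aa Ay Az e]]]]] := step _ qA.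
  by case: (A1 a (y + z)); rewrite ?rpredD //; apply: etrans e; ring.
have step1 x : x \in Aint -> A x \/ exists a y, [/\ A a, y \in Aint & a + x * y = 1].
  move=> Ax; have [|[a [y [z [Aa Ay Az e]]]]] := step _ Ax; [by left | right].
  exists (a + z * q%:R), y; split=> //; first by apply: AD => //; apply: AM.
  by apply: etrans e; ring.
have nA1 : ~ A 1 by move=> h; apply: (A1 1 0); rewrite ?rpred0 // mulr0 addr0.
exists A; split=> // x y Ax Ay Axy.
have [|[a [u [Aa Au e]]]] := step1 _ Ax; first by left.
have [|[b [v [Ab Av e']]]] := step1 _ Ay; first by right.
(* The product of the two expressions for 1 lies in [A], since each of its terms contains a, b or
   xy. *)
case: nA1; rewrite -[1]mulr1 -{1}e -{1}e'.
have -> : (a + x * u) * (b + y * v) = (b + y * v) * a + (x * u) * b + (u * v) * (x * y).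
  by ring.
by apply: (AD _ _ (AD _ _ _ _)); apply: AM => //; rewrite ?e' ?rpred1 // rpredM.
Qed.

Section AintPrimeTheory.

Variables (q : nat) (M : set algC).
Hypothesis Mq : Aint_prime q M.

Lemma AP0 : M 0.
Proof. by rewrite -(subrr q%:R); apply: (AP_B Mq) => //; exact: (AP_char Mq). Qed.

Lemma APN x : M x -> M (- x).
Proof. by move=> Mx; rewrite -sub0r; apply: (AP_B Mq) => //; apply: AP0. Qed.

Lemma APD x y : M x -> M y -> M (x + y).
Proof. by move=> Mx My; rewrite -[y]opprK; apply: (AP_B Mq) => //; apply: APN. Qed.

Lemma AP_Mr x y : M x -> y \in Aint -> M (x * y).
Proof. by move=> Mx Ay; rewrite mulrC; apply: (AP_Ml Mq). Qed.

Lemma AP_X x n : x \in Aint -> M (x ^+ n) -> M x.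
Proof.
move=> Ax; elim: n => [|n IH]; first by move/(AP_1 Mq).
by rewrite exprS => /(AP_M Mq)[]; rewrite ?rpredX.
Qed.

Lemma AP_sum (I : Type) (r : seq I) (P : pred I) (F : I -> algC) :
  (forall i, P i -> M (F i)) -> M (\sum_(i <- r | P i) F i).
Proof. by move=> h; apply: big_ind => //; [apply: AP0 | apply: APD]. Qed.

Lemma AP_prod (I : eqType) (r : seq I) (F : I -> algC) :
  {in r, forall i, F i \in Aint} -> M (\prod_(i <- r) F i) ->
  exists2 i, i \in r & M (F i).
Proof.
elim: r => [|i r IH] AF; first by rewrite big_nil => /(AP_1 Mq).
have Ar : {in r, forall j, F j \in Aint}.
  by move=> j rj; apply: AF; rewrite inE rj orbT.
rewrite big_cons => /(AP_M Mq)[||Mi|/(IH Ar)[j rj Mj]].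
- by rewrite AF ?mem_head.
- by rewrite big_seq rpred_prod.
- by exists i; rewrite ?mem_head.
- by exists j; rewrite // inE rj orbT.
Qed.

Lemma AP_int (m : int) : M m%:~R <-> (q %| m)%Z.
Proof.
split=> [Mm|/dvdzP[n ->]]; last first.
  by rewrite intrM; apply: (AP_Ml Mq); [rewrite rpred_int | exact: (AP_char Mq)].
apply/negPn/negP => ndv; apply: (AP_1 Mq).
have cop : coprimez q m.
  by rewrite coprimezE prime_coprime ?(AP_prime Mq) //= -dvdzE.
have [u [v uv]] := Bezoutz q m.
move: cop uv; rewrite /coprimez => /eqP -> uv.
have -> : 1 = u%:~R * q%:R + v%:~R * m%:~R :> algC.
  by rewrite -[q%:R]/(q%:Z%:~R) -!intrM -intrD uv.
by apply: APD; apply: (AP_Ml Mq); rewrite ?rpred_int //; apply: (AP_char Mq).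
Qed.

Lemma AP_nat m : M m%:R <-> (q %| m)%N.
Proof. exact: (AP_int m). Qed.

End AintPrimeTheory.

(** * Transpositions from ramification *)

Lemma Aint_horner (h : {poly int}) x : x \in Aint -> (pZtoC h).[x] \in Aint.
Proof.
move=> Ax; elim/poly_ind: h => [|h c IH]; first by rewrite rmorph0 horner0 rpred0.
rewrite rmorphD rmorphM /= map_polyX map_polyC hornerMXaddC.
by rewrite rpredD ?rpredM ?rpred_int.
Qed.

Section Unramified.

Variables (q : nat) (M : set algC).
Hypothesis Mq : Aint_prime q M.

(* Modulo q, strip from h the factors 'X, which do not vanish at a: what is left
   vanishes at a but not at 0, hence not at x. *)
Lemma prime_separation (h : {poly int}) (x a : algC) :
    x \in Aint -> a \in Aint -> M x -> ~ M a ->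
    (exists i, ~~ (q %| h`_i)%Z) -> M (pZtoC h).[a] ->
  exists h1 : {poly int}, M (pZtoC h1).[a] /\ ~ M (pZtoC h1).[x].
Proof.
move=> Ax Aa Mx nMa; elim/poly_ind: h => [|h c IH] [i].
  by rewrite coef0 dvdz0.
have [qc|nqc] := boolP (q %| c)%Z; last first.
  move=> _ Ma; exists (h * 'X + c%:P); split=> //.
  rewrite rmorphD rmorphM /= map_polyX map_polyC hornerMXaddC => Mhx.
  case/negP: nqc; apply/(AP_int Mq).
  rewrite -[c%:~R](addKr ((pZtoC h).[x] * x)) addrC; apply: (AP_B Mq) => //.
  by apply: (AP_Ml Mq) => //; apply: Aint_horner.
case: i => [|i]; first by rewrite coefD coefMX coefC /= add0r qc.
rewrite coefD coefMX coefC /= addr0 => nqi.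
rewrite rmorphD rmorphM /= map_polyX map_polyC hornerMXaddC => Ma.
have Mha : M ((pZtoC h).[a] * a).
  rewrite -[_ * a](addrK c%:~R); apply: (AP_B Mq) => //.
  exact/(AP_int Mq).
have [Mh|//] := AP_M Mq (Aint_horner h Aa) Aa Mha.
by apply: IH => //; exists i.
Qed.

Variables (I : finType) (nu : I -> {rmorphism algC -> algC}) (i0 : I).
Variable K : algC -> Prop.
Hypotheses (K_rat : forall a : rat, K (ratr a))
  (K_B : forall x y, K x -> K y -> K (x - y))
  (K_M : forall x y, K x -> K y -> K (x * y))
  (K_nu : forall i x, K x -> K (nu i x))
  (nu_i0 : forall x, K x -> nu i0 x = x)
  (nu_tr : forall x, K x -> \sum_i nu i x \in Crat).

Let K_1 : K 1. Proof. by have := K_rat 1; rewrite rmorph1. Qed.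
Let K_0 : K 0. Proof. by rewrite -(subrr 1); apply: K_B. Qed.
Let K_D x y : K x -> K y -> K (x + y).
Proof. by move=> Kx Ky; rewrite -[y]opprK -[- y]sub0r; do 2?[apply: (K_B) => //]. Qed.

Let K_prod (J : Type) (r : seq J) (P : pred J) (F : J -> algC) :
  (forall j, P j -> K (F j)) -> K (\prod_(j <- r | P j) F j).
Proof. by move=> h; apply: big_ind => //; apply: K_M. Qed.

Let K_horner (h : {poly int}) x : K x -> K (pZtoC h).[x].
Proof.
move=> Kx; elim/poly_ind: h => [|h c IH]; first by rewrite rmorph0 horner0.
rewrite rmorphD rmorphM /= map_polyX map_polyC hornerMXaddC.
apply: K_D; first exact: K_M.
by have := K_rat c%:~R; rewrite rmorph_int.
Qed.

(** Induction on [us]: the first factor splits the sum into one for [x * u.1] and one for [x]. With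
    no factor left, the sum is the trace of [x], a rational integer lying in [M], hence a multiple
    of [q]. *)
Lemma trace_product_dvd (us : seq (algC * algC)) (x : algC) :
    {in us, forall u, [/\ u.1 \in Aint, u.2 \in Aint & K u.1]} ->
    x \in Aint -> K x -> (forall i, M (nu i x)) ->
  exists2 z, z \in Aint &
    \sum_i nu i x * \prod_(u <- us) (nu i u.1 - u.2) = q%:R * z.
Proof.
elim: us x => [|u us IH] x Hus Ax Kx Mx.
  under eq_bigr do rewrite big_nil mulr1.
  have Atr : \sum_i nu i x \in Aint by rewrite rpred_sum // => i _; rewrite Aint_aut.
  have /intrP[m Dm] := Cint_rat_Aint (nu_tr Kx) Atr.
  have /(AP_int Mq)/dvdzP[n Dn] : M m%:~R by rewrite -Dm; apply: (AP_sum Mq).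
  by exists n%:~R; rewrite ?rpred_int // Dm Dn intrM mulrC.
have [Au1 Au2 Ku1] := Hus u (mem_head _ _).
have {}Hus : {in us, forall u, [/\ u.1 \in Aint, u.2 \in Aint & K u.1]}.
  by move=> v vus; apply: Hus; rewrite inE vus orbT.
have [|||z1 Az1 E1] := IH (x * u.1) Hus; first by rewrite rpredM.
- exact: K_M.
- by move=> i; rewrite rmorphM; apply: (AP_Mr Mq); rewrite ?Aint_aut.
have [z2 Az2 E2] := IH x Hus Ax Kx Mx.
exists (z1 - u.2 * z2); first by rewrite rpredB ?rpredM.
rewrite mulrBr mulrCA -E1 -E2 mulr_sumr -sumrB; apply: eq_bigr => i _.
by rewrite big_cons rmorphM /=; ring.
Qed.

(** That is, the inertia group of [M] in the Galois group of [K] is trivial. *)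
Hypothesis nu_move : forall i, i != i0 ->
  exists u, [/\ u \in Aint, K u & ~ M (u - nu i u)].

(** Take for [e] the product of the u_i - nu_i(u_i) over i other than [i0]. In the sum of
    [trace_product_dvd] the term of each such i contains the factor nu_i(u_i) - nu_i(u_i) = 0, and
    only [x * e] survives. *)
Lemma unramified_dvd : exists e, [/\ e \in Aint, K e, ~ M e &
  forall x, x \in Aint -> K x -> (forall i, M (nu i x)) ->
    exists2 z, z \in Aint & x * e = q%:R * z].
Proof.
have [u Hu] : {u : I -> algC & forall i, i != i0 ->
    [/\ u i \in Aint, K (u i) & ~ M (u i - nu i (u i))]}.
  apply: (@choice _ _ (fun (i : I) (v : algC) =>
    i != i0 -> [/\ v \in Aint, K v & ~ M (v - nu i v)])).
  by move=> i; have [->|/nu_move[v Hv]] := eqVneq i i0; [exists 0 | exists v].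
pose us := [seq (u i, nu i (u i)) | i <- enum I & i != i0].
have Hus : {in us, forall v, [/\ v.1 \in Aint, v.2 \in Aint & K v.1]}.
  move=> v /mapP[i]; rewrite mem_filter => /andP[/Hu[Ai Ki _] _] ->.
  by split; rewrite //= Aint_aut.
exists (\prod_(v <- us) (v.1 - v.2)); split=> [||Me|x Ax Kx Mx].
- by rewrite big_seq rpred_prod // => v /Hus[? ? _]; rewrite rpredB.
- rewrite big_map big_filter; apply: K_prod => i /Hu[_ Ki _] /=.
  by apply: K_B => //; apply: K_nu.
- case: (AP_prod Mq _ Me) => [v /Hus[? ? _]|v /mapP[i]]; first by rewrite rpredB.
  by rewrite mem_filter => /andP[/Hu[_ _ nMi] _] ->.
have [z Az Ez] := trace_product_dvd Hus Ax Kx Mx.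
exists z => //; rewrite -Ez (bigD1 i0) //= nu_i0 // [X in _ + X]big1 ?addr0.
  congr (_ * _); apply: eq_big_seq => v /Hus[_ _ Kv].
  by rewrite nu_i0.
move=> i ni0; have Ui : i \in [seq j <- enum I | j != i0].
  by rewrite mem_filter ni0 mem_enum.
have Uu : uniq [seq j <- enum I | j != i0] by rewrite filter_uniq ?enum_uniq.
by rewrite big_map (bigD1_seq i Ui Uu) /= subrr mul0r mulr0.
Qed.

(** So [q] generates the maximal ideal of the local ring at [M]. A factor outside [M] first brings
    all conjugates of [x] into [M], as [unramified_dvd] requires. *)
Lemma unramified_uniformizer x : x \in Aint -> K x -> M x ->
  exists y z, [/\ y \in Aint, K y & ~ M y] /\ [/\ z \in Aint, K z & x * y = q%:R * z].
Proof.
move=> Ax Kx Mx; have [e [Ae Ke nMe He]] := unramified_dvd.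
have [y Hy] : {y : I -> algC & forall i,
    [/\ y i \in Aint, K (y i), ~ M (y i) & M (nu i (x * y i))]}.
  apply: (@choice _ _ (fun (i : I) (v : algC) =>
    [/\ v \in Aint, K v, ~ M v & M (nu i (x * v))])) => i.
  have [Mi|nMi] := pselect (M (nu i x)).
    exists 1; split; rewrite ?rpred1 ?mulr1 //; exact: (AP_1 Mq).
  (* The minimal polynomial of [x] is monic, hence nonzero modulo [q], and vanishes at the conjugate
     [nu i x]; [h1] then separates this conjugate from [x] modulo [M]. *)
  have /floorpP[h Dh] : minCpoly x \is a polyOver Num.int by [].
  have [||||||h1 [M1 nM1]] := @prime_separation h x (nu i x); rewrite ?Aint_aut //.
  - exists (size h).-1; rewrite -lead_coefE.
    have := minCpoly_monic x; rewrite Dh monicE lead_coef_map_inj //; last exact: intr_inj.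
    rewrite (eqr_int _ _ 1) => /eqP->; rewrite dvdz1 /= eqn_leq leqNgt prime_gt1 //.
    exact: AP_prime Mq.
  - have := root_minCpoly (nu i x); rewrite minCpoly_aut Dh => /rootP ->.
    exact: AP0 Mq.
  exists (pZtoC h1).[x]; split; [exact: Aint_horner|exact: K_horner|by []|].
  rewrite rmorphM; apply: (AP_Ml Mq); first by rewrite Aint_aut.
  rewrite -horner_map -map_poly_comp (eq_map_poly (g := intr)) // => m /=.
  by rewrite rmorph_int.
pose y0 := \prod_i y i.
have Ay0 : y0 \in Aint by rewrite rpred_prod // => i _; have [] := Hy i.
have Ky0 : K y0 by apply: K_prod => i _; have [] := Hy i.
have nMy0 : ~ M y0.
  by case/(AP_prod Mq) => [i _|i _]; have [] := Hy i.
have [||i|z Az Ez] := He (x * y0); first by rewrite rpredM.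
- exact: K_M.
- rewrite /y0 (bigD1 i) //= mulrA rmorphM; apply: (AP_Mr Mq); first by have [] := Hy i.
  by rewrite Aint_aut rpred_prod // => j _; have [] := Hy j.
exists (y0 * e), z; split; [split|split] => //; rewrite ?rpredM ?mulrA //.
- exact: K_M.
- by case/(AP_M Mq).
have nzq : q%:R != 0 :> algC by rewrite pnatr_eq0 -lt0n prime_gt0 ?(AP_prime Mq).
have -> : z = x * y0 * e * ratr (q%:R)^-1.
  by rewrite Ez fmorphV rmorph_nat mulrAC mulfV ?mul1r.
by do 3?apply: (K_M) => //.
Qed.

(** As [b] is outside [M], the relation bounds the valuation of [x] by [v], so extracting factors
    [q] with [unramified_uniformizer] stops. Elements outside [M] stand for units of the local
    ring. *)
Lemma unramified_valuation v x x' b : x \in Aint -> K x -> x' \in Aint ->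
    b \in Aint -> ~ M b -> x * x' = q%:R ^+ v * b ->
  exists i y z, [/\ y \in Aint, z \in Aint, ~ M y, ~ M z & x * y = q%:R ^+ i * z].
Proof.
have nzq : q%:R != 0 :> algC by rewrite pnatr_eq0 -lt0n prime_gt0 ?(AP_prime Mq).
elim: v x b => [|v IH] x b Ax Kx Ax' Ab nMb E.
all: have [Mx|nMx] := pselect (M x); last first.
  1,3: by exists 0%N, 1, x; rewrite rpred1 mulr1 mul1r; split=> //; exact: AP_1 Mq.
  by case: nMb; rewrite -[b]mul1r -E; exact: (AP_Mr Mq).
have [y [z [[Ay Ky nMy] [Az Kz Exy]]]] := unramified_uniformizer Ax Kx Mx.
have [||||||i [y1 [z1 [Ay1 Az1 nMy1 nMz1 E1]]]] := IH z (b * y); rewrite ?rpredM //.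
- by case/(AP_M Mq).
- by apply: (mulfI nzq); transitivity (x * y * x'); [rewrite Exy | rewrite mulrAC E exprS]; ring.
exists i.+1, (y * y1), z1; split; rewrite ?rpredM //.
- by case/(AP_M Mq).
- by rewrite mulrA Exy -mulrA E1 exprS mulrA.
Qed.

(** Let i and j be the valuations of [R] and [S]; the first relation gives i + j = v. If i < j, then
    R + S has valuation i but RSw at least i + j > i, against the second relation. By symmetry i = j
    and v = 2i. *)
Lemma unramified_quadratic_even v R S b eta g w :
    [/\ R \in Aint, K R & M R] -> [/\ S \in Aint, K S & M S] ->
    [/\ b \in Aint, eta \in Aint, g \in Aint & w \in Aint] ->
    [/\ ~ M b, ~ M eta & ~ M g] ->
    R * S * eta = q%:R ^+ v * b -> (R + S) * g = R * S * w -> ~~ odd v.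
Proof.
move=> [AR KR MR] [AS KS MS] [Ab Aeta Ag Aw] [nMb nMeta nMg] E1 E2.
have nzq : q%:R != 0 :> algC by rewrite pnatr_eq0 -lt0n prime_gt0 ?(AP_prime Mq).
have nMM x y : x \in Aint -> y \in Aint -> ~ M x -> ~ M y -> ~ M (x * y).
  by move=> Ax Ay nMx nMy /(AP_M Mq)[].
have AX n : q%:R ^+ n \in Aint by rewrite rpredX ?rpred_nat.
have MX n x : x \in Aint -> M (q%:R ^+ n.+1 * x).
  move=> Ax; rewrite exprS -mulrA; apply: (AP_Mr Mq); first exact: AP_char Mq.
  by rewrite rpredM.
have [||||||i [y [z [Ay Az nMy nMz Ei]]]] := @unramified_valuation v R (S * eta) b;
  rewrite ?rpredM ?mulrA //.
have [||||||j [y' [z' [Ay' Az' nMy' nMz' Ej]]]] := @unramified_valuation v S (R * eta) b;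
  rewrite ?rpredM ?mulrA ?[S * R]mulrC //.
have Eij : q%:R ^+ (i + j) * (z * z' * eta) = q%:R ^+ v * (b * (y * y')).
  transitivity (R * S * eta * (y * y')); last by rewrite E1; ring.
  transitivity ((q%:R ^+ i * z) * (q%:R ^+ j * z') * eta); first by rewrite exprD; ring.
  by rewrite -Ei -Ej; ring.
have cancelX m n X Y : q%:R ^+ m * X = q%:R ^+ n * Y -> (m < n)%N -> Y \in Aint -> M X.
  move=> E lt AY; suff -> : X = q%:R ^+ (n - m.+1).+1 * Y by apply: MX.
  apply: (mulfI (expf_neq0 m nzq)); rewrite E [RHS]mulrA -exprD.
  by rewrite addnS -addSn subnKC.
have Dv : (i + j = v)%N.
  have [lt|lt|//] := ltngtP (i + j) v.
    case: (@nMM (z * z') eta); rewrite ?rpredM //; first exact: nMM.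
    by apply: (cancelX _ _ _ _ Eij lt); rewrite !rpredM.
  case: (@nMM b (y * y')); rewrite ?rpredM //; first exact: nMM.
  by apply: (cancelX _ _ _ _ (esym Eij) lt); rewrite !rpredM.
have lt_absurd R1 S1 i1 j1 (y1 z1 y2 z2 : algC) : y1 \in Aint -> z1 \in Aint ->
    y2 \in Aint -> z2 \in Aint -> ~ M z1 -> ~ M y2 -> R1 * y1 = q%:R ^+ i1 * z1 ->
    S1 * y2 = q%:R ^+ j1 * z2 -> (R1 + S1) * g = R1 * S1 * w -> ~ (i1 < j1)%N.
  move=> Ay1 Az1 Ay2 Az2 nMz1 nMy2 F1 F2 F3 lt; case: (@nMM (z1 * y2) g); rewrite ?rpredM //.
    exact: nMM.
  have Dj : j1 = (i1 + (j1 - i1.+1).+1)%N by rewrite addnS -addSn subnKC.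
  have -> : z1 * y2 * g = q%:R ^+ (j1 - i1.+1).+1 * (q%:R ^+ i1 * (z1 * z2 * w) - z2 * y1 * g).
    apply: (mulfI (expf_neq0 i1 nzq)); rewrite [RHS]mulrA -exprD -Dj mulrBr.
    apply/eqP; rewrite eq_sym subr_eq; apply/eqP.
    transitivity ((q%:R ^+ i1 * z1) * (q%:R ^+ j1 * z2) * w); first by ring.
    rewrite -F1 -F2; transitivity ((R1 + S1) * g * (y1 * y2)); first by rewrite F3; ring.
    transitivity ((R1 * y1) * y2 * g + (S1 * y2) * y1 * g); first by ring.
    by rewrite F1 F2; ring.
  by apply: MX; rewrite rpredB ?rpredM.
rewrite -Dv; have [lt|lt|->] := ltngtP i j; last by rewrite addnn odd_double.
  by case: (lt_absurd R S i j y z y' z').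
by case: (lt_absurd S R j i y' z' y z) => //; rewrite addrC [S * R]mulrC.
Qed.

End Unramified.

Definition transposes (rs : seq algC) (r s : algC) : Prop :=
  exists nu : {rmorphism algC -> algC},
    [/\ nu r = s, nu s = r & {in rs, forall x, x != r -> x != s -> nu x = x}].

Lemma aut_roots (f : {poly rat}) (rs : seq algC) (nu : {rmorphism algC -> algC}) x :
  pQtoC f = \prod_(r <- rs) ('X - r%:P) -> (nu x \in rs) = (x \in rs).
Proof.
move=> Df; rewrite -!root_prod_XsubC -Df -[RHS](fmorph_root nu) -map_poly_comp.
by congr (root _ _); apply: eq_map_poly => c; rewrite /= fmorph_rat.
Qed.

(** If [r] and [s] cannot be exchanged, every nontrivial automorphism of the field of roots moves a
    root u other than [r] and [s]. By the separation hypothesis u and its image differ modulo [M],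
    so inertia is trivial and [v] would be even. *)
Lemma ramified_transposition (f : {poly rat}) (rs : seq algC) q M (a : int)
    (r s : algC) v b eta g w :
    pQtoC f = \prod_(r <- rs) ('X - r%:P) -> uniq rs -> {subset rs <= Aint} ->
    Aint_prime q M -> r \in rs -> s \in rs ->
    (forall x y, x \in rs -> y \in rs -> x != y -> M (x - y) -> (x == r) || (x == s)) ->
    M (a%:~R - r) -> M (a%:~R - s) ->
    [/\ b \in Aint, eta \in Aint, g \in Aint & w \in Aint] ->
    [/\ ~ M b, ~ M eta & ~ M g] -> odd v ->
    (a%:~R - r) * (a%:~R - s) * eta = q%:R ^+ v * b ->
    (a%:~R - r + (a%:~R - s)) * g = (a%:~R - r) * (a%:~R - s) * w ->
  transposes rs r s.
Proof.
move=> Df Urs Ars Mq rsr rss sep Mr Ms A4 nM3 odd_v E1 E2; apply: contrapT => ntr.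
have [I [nu [i0 [K [[Krs Krat KB KM Knu] nu0 nu_move nu_tr]]]]] := galois_transversal Df Urs.
have Ka : K a%:~R by have := Krat a%:~R; rewrite rmorph_int.
have Aa : a%:~R \in Aint by rewrite rpred_int.
have sepI i : i != i0 -> exists u, [/\ u \in Aint, K u & ~ M (u - nu i u)].
  move=> ni0.
  have [u [rsu nur nus num]] : exists u, [/\ u \in rs, u != r, u != s & nu i u != u].
    apply: contrapT => no.
    have fixu u : u \in rs -> u != r -> u != s -> nu i u = u.
      by move=> ru nr ns; apply/eqP/negPn/negP => nf; case: no; exists u.
    (* An image outside {r, s} would be fixed, hence equal to [x] by injectivity. *)
    have rs_nu x : x \in rs -> (x == r) || (x == s) -> (nu i x == r) || (nu i x == s).
      move=> rx xrs; apply/negPn/negP; rewrite negb_or => /andP[nr ns].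
      have /fmorph_inj Ex : nu i (nu i x) = nu i x by apply: fixu; rewrite ?(aut_roots _ _ Df).
      by case/orP: xrs => /eqP Dx; move: nr ns; rewrite Ex Dx eqxx.
    have [x rx nx] := nu_move i ni0.
    have rrs : (r == r) || (r == s) by rewrite eqxx.
    have srs : (s == r) || (s == s) by rewrite eqxx orbT.
    have xrs : (x == r) || (x == s).
      by apply/negPn/negP; rewrite negb_or => /andP[nr ns]; rewrite fixu ?eqxx in nx.
    case/orP: (rs_nu _ rsr rrs) => /eqP Er.
      case/orP: (rs_nu _ rss srs) => /eqP Es.
        have Ers : r = s by apply: (fmorph_inj (nu i)); rewrite Er Es.
        by case/orP: xrs nx => /eqP ->; rewrite ?Er ?Es ?Ers eqxx.
      by case/orP: xrs nx => /eqP ->; rewrite ?Er ?Es eqxx.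
    case/orP: (rs_nu _ rss srs) => /eqP Es.
      by case: ntr; exists (nu i).
    have Ers : r = s by apply: (fmorph_inj (nu i)); rewrite Er Es.
    by case/orP: xrs nx => /eqP ->; rewrite ?Er ?Es ?Ers eqxx.
  exists u; split; [exact: Ars | exact: Krs | move=> Mu].
  have rn : nu i u \in rs by rewrite (aut_roots _ _ Df).
  have nn : u != nu i u by rewrite eq_sym.
  have := sep _ _ rsu rn nn Mu.
  by rewrite (negPf nur) (negPf nus).
have KA x : x \in rs -> a%:~R - x \in Aint /\ K (a%:~R - x).
  by move=> rx; split; [apply: rpredB => //; apply: Ars | apply: KB => //; apply: Krs].
have [[Ar Kr] [As Ks]] := (KA r rsr, KA s rss).
by have := unramified_quadratic_even Mq Krat KB KM Knu nu0 nu_tr sepI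
  (And3 Ar Kr Mr) (And3 As Ks Ms) A4 nM3 E1 E2; rewrite odd_v.
Qed.

(** * Permutations of the fibres *)

(** Remove the classes one at a time; each accounts for [c] entries of [s]. *)
Lemma uniform_classes_dvd (T : eqType) (e : rel T) (c : nat) (s : seq T) :
    reflexive e -> symmetric e -> transitive e ->
    {in s, forall y, count (e y) s = c} -> (c %| size s)%N.
Proof.
move=> er es et; have [m] := ubnP (size s); elim: m s => // m IH [|y s0] //.
set s := y :: s0; move=> lt_sm Hc; have sy : y \in s by rewrite mem_head.
pose s' := [seq z <- s | ~~ e y z].
have sz : size s = (c + size s')%N.
  by rewrite -(count_predC (e y) s) (Hc y sy) size_filter.
rewrite sz dvdn_addr //; apply: IH => [|z].
  apply: leq_trans (_ : size s <= m)%N => //.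
  rewrite size_filter -(count_predC (e y) s) -addn1 addnC leq_add2r -has_count.
  by apply/hasP; exists y.
rewrite mem_filter => /andP[nez sz']; rewrite -(Hc z sz') count_filter.
apply: eq_count => u /=; case ezu: (e z u) => //=.
by apply: contra nez => eyu; apply: et eyu _; rewrite es.
Qed.

Lemma count_ltn (T : eqType) (P Q : pred T) (s : seq T) (x : T) :
    {in s, forall y, Q y -> P y} -> x \in s -> P x -> ~~ Q x ->
  (count Q s < count P s)%N.
Proof.
move=> sQP sx Px nQx; rewrite -[count P s]size_filter -(count_predC Q) !count_filter.
have -> : count (predI Q P) s = count Q s.
  by apply: eq_in_count => y sy /=; apply/andP/idP => [[]|Qy] //; split=> //; apply: sQP.
rewrite -addn1 leq_add2l -has_count; apply/hasP; exists x => //=.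
by rewrite nQx Px.
Qed.

Lemma transposes_refl rs x : transposes rs x x.
Proof. by exists idfun. Qed.

Lemma transposes_sym rs x y : transposes rs x y -> transposes rs y x.
Proof. by case=> nu [nx ny nz]; exists nu; split=> // z rz zy zx; apply: nz. Qed.

(** (x z) is the conjugate of (y z) by (x y). *)
Lemma transposes_trans rs x y z : x \in rs -> y \in rs -> z \in rs ->
  transposes rs x y -> transposes rs y z -> transposes rs x z.
Proof.
move=> rx ry rz; have [->|nxy] := eqVneq x y; first by [].
have [->|nyz] := eqVneq y z; first by [].
have [-> _ _|nxz] := eqVneq x z; first exact: transposes_refl.
move=> [n1 [n1x n1y n1o]] [n2 [n2y n2z n2o]].
exists (n1 \o n2 \o n1); split=> [||u ru nux nuz] /=.
- by rewrite n1x n2y n1o // eq_sym.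
- by rewrite (n1o z) 1?eq_sym // n2z n1y.
have [->|nuy] := eqVneq u y; first by rewrite n1y (n2o x) // n1x.
by rewrite (n1o u) // (n2o u) // n1o.
Qed.

Lemma transposes_aut rs x y (mu : {rmorphism algC -> algC}) :
    (forall (nu : {rmorphism algC -> algC}) z, (nu z \in rs) = (z \in rs)) ->
  transposes rs x y -> transposes rs (mu x) (mu y).
Proof.
move=> rs_nu [nu [nx ny no]].
exists (mu \o nu \o algC_invaut mu); split=> [||z rz nzx nzy] /=.
- by rewrite algC_autK nx.
- by rewrite algC_autK ny.
rewrite no ?algC_invautK ?rs_nu //.
  by apply: contra nzx => /eqP <-; rewrite algC_invautK.
by apply: contra nzy => /eqP <-; rewrite algC_invautK.
Qed.

Section Fibres.

Variables (p : nat) (f : algC -> algC) (rs : seq algC).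
Hypotheses (pr_p : prime p)
  (f_nu : forall (nu : {rmorphism algC -> algC}) x, nu (f x) = f (nu x))
  (rs_nu : forall (nu : {rmorphism algC -> algC}) x, (nu x \in rs) = (x \in rs))
  (rs_tr : {in rs &, forall x y, exists nu : {rmorphism algC -> algC}, nu x = y})
  (fib : {in rs, forall x, exists ss, [/\ uniq ss, size ss = p &
     forall y, (y \in ss) = (y \in rs) && (f y == f x)]})
  (rs_transp : exists r s, [/\ r \in rs, s \in rs, r != s, f r = f s & transposes rs r s]).

Lemma fibre_transpositions : {in rs &, forall x y, f x = f y -> transposes rs x y}.
Proof.
(* The clause [x = y] makes [e] reflexive on all of [algC], as [uniform_classes_dvd] asks. *)
pose e x y := `[< x = y \/ [/\ x \in rs, y \in rs & transposes rs x y] >].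
have er : reflexive e by move=> x; apply/asboolP; left.
have es : symmetric e.
  suff h x y : e x y -> e y x by move=> x y; apply/idP/idP; apply: h.
  move=> /asboolP[->|[rx ry t]]; apply/asboolP; [by left | right].
  by split=> //; apply: transposes_sym.
have et : transitive e.
  move=> y x z /asboolP[->|[rx ry t]] // /asboolP[<-|[_ rz t']]; apply/asboolP; right=> //.
  by split=> //; apply: transposes_trans t t'.
(* An automorphism taking [x] to [y] maps the class of [x] in its fibre injectively into that of
   [y]. *)
have le_count x y ss ss' : x \in rs -> y \in rs -> uniq ss -> uniq ss' ->
    (forall z, (z \in ss) = (z \in rs) && (f z == f x)) ->
    (forall z, (z \in ss') = (z \in rs) && (f z == f y)) ->
  (count (e x) ss <= count (e y) ss')%N.
  move=> rx ry Us Us' ms ms'; have [mu Dy] := rs_tr rx ry.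
  rewrite -!size_filter -(size_map mu); apply: uniq_leq_size.
    by rewrite map_inj_uniq ?filter_uniq //; apply: fmorph_inj.
  move=> _ /mapP[z + ->]; rewrite !mem_filter ms ms' => /and3P[exz rz /eqP fz].
  rewrite rs_nu rz -f_nu fz f_nu Dy eqxx !andbT.
  case/asboolP: exz => [<-|[_ _ t]]; first by rewrite Dy.
  by rewrite -Dy; apply/asboolP; right; split; rewrite ?rs_nu //; apply: transposes_aut.
move=> x y rx ry fxy; have [ss [Us szs ms]] := fib rx.
have c_ge2 : (1 < count (e x) ss)%N.
  have [r [s [rr rs_s nrs frs t]]] := rs_transp.
  have [sr [Usr _ msr]] := fib rr.
  apply: leq_trans (le_count r x sr ss rr rx Usr Us msr ms).
  rewrite -size_filter; apply: (@uniq_leq_size _ [:: r; s]); first by rewrite /= inE nrs.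
  move=> z; rewrite !inE mem_filter msr => /orP[/eqP->|/eqP->];
    rewrite ?rr ?rs_s ?frs ?eqxx ?andbT //.
  by apply/asboolP; right.
have : (count (e x) ss %| p)%N.
  rewrite -szs; apply: (uniform_classes_dvd er es et) => z; rewrite ms => /andP[rz /eqP fz].
  have mz u : (u \in ss) = (u \in rs) && (f u == f z) by rewrite fz ms.
  by apply/eqP; rewrite eqn_leq !le_count.
(* The class size divides the prime [p] and exceeds 1, so the class is the whole fibre. *)
case/primeP: pr_p => _ dvp /dvp; rewrite gtn_eqF //= -szs -all_count => /allP/(_ y).
rewrite ms ry fxy eqxx => /(_ isT) /asboolP[->|[]//].
exact: transposes_refl.
Qed.

(** Induction on the number of points moved: composing with the transposition of [x] and [g x] makes
    [x] fixed and moves no new point. *)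
Lemma fibre_permutations (g : algC -> algC) :
    {in rs, forall x, g x \in rs} -> {in rs &, injective g} ->
    {in rs, forall x, f (g x) = f x} ->
  exists nu : {rmorphism algC -> algC}, {in rs, nu =1 g}.
Proof.
have [m] := ubnP (count (fun x => g x != x) rs); elim: m g => // m IH g lt_m grs ginj fg.
have [/hasP[x rx ngx]|/hasPn fix_g] := boolP (has (fun x => g x != x) rs); last first.
  by exists idfun => x /fix_g /negPn /eqP ->.
have [nu0 [n1 n2 n3]] := fibre_transpositions rx (grs x rx) (esym (fg x rx)).
have nu0K y : y \in rs -> nu0 (nu0 y) = y.
  move=> ry; have [->|nyx] := eqVneq y x; first by rewrite n1.
  have [->|nyg] := eqVneq y (g x); first by rewrite n2.
  by rewrite !n3.
have f_nu0 y : y \in rs -> f (nu0 y) = f y.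
  move=> ry; have [->|nyx] := eqVneq y x; first by rewrite n1 fg.
  have [->|nyg] := eqVneq y (g x); first by rewrite n2 fg.
  by rewrite n3.
have [||||nu' Hnu'] := IH (nu0 \o g).
- rewrite -ltnS; apply: (leq_trans _ lt_m); rewrite ltnS.
  apply: (count_ltn (x := x)) => //=; last by rewrite n2 eqxx.
  move=> y ry; have [->|nyx] := eqVneq y x; first by rewrite n2 eqxx.
  apply: contra => /eqP gy; rewrite gy n3 //.
  by apply: contraNneq nyx => Dy; apply/eqP; apply: ginj => //; rewrite gy.
- by move=> y ry /=; rewrite rs_nu grs.
- by move=> y z ry rz /= /fmorph_inj/ginj; apply.
- by move=> y ry /=; rewrite f_nu0 ?grs ?fg.
exists (nu0 \o nu') => y ry /=.
by rewrite Hnu' //= nu0K ?grs.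
Qed.

End Fibres.

(** * The preimage tree *)

Lemma vertex_eq (f : {poly algC}) (u v : vertex f) :
  lvl u = lvl v -> pt u = pt v -> u = v.
Proof.
case: u v => [n x Px] [m y Py] /= En Ex; subst m y.
by congr (@Vertex f n x _); apply: bool_irrelevance.
Qed.

Lemma vertex_exists (f : {poly algC}) n x :
  fiter f n x = 0 -> exists v : vertex f, lvl v = n /\ pt v = x.
Proof. by move/eqP=> Px; exists (Vertex Px). Qed.

Lemma fiter_pt (f : {poly algC}) (v : vertex f) : fiter f (lvl v) (pt v) = 0.
Proof. exact/eqP/ptP. Qed.

Lemma parent_exists (f : {poly algC}) (v : vertex f) n : lvl v = n.+1 ->
  exists u : vertex f, lvl u = n /\ pt u = f.[pt v].
Proof.
move=> Dn; apply: vertex_exists; rewrite -(fiter_pt v) Dn.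
by rewrite /fiter iterSr.
Qed.

Section TreeAut.

Variables (f : {poly algC}) (d : nat).
Hypothesis (fibre : forall n al, fiter f n al = 0 -> exists ss : seq algC,
  [/\ uniq ss, size ss = d & forall x, (x \in ss) = (f.[x] == al)]).
Variable t : vertex f -> vertex f.
Hypothesis t_aut : is_tree_aut t.

(* The root is the only vertex of degree d: all others have degree d + 1. *)
Lemma tree_aut_root (v : vertex f) : lvl v = 0%N -> lvl (t v) = 0%N.
Proof.
move=> v0; case Dtv: (lvl (t v)) => [//|m]; exfalso.
have [[t' t'K tK'] t_edge] := t_aut.
have ptv0 : pt v = 0 by have := fiter_pt v; rewrite v0.
have [ss0 [Us0 sz0 ms0]] := @fibre 0 0 erefl.
have [ss [Us sz ms]] := fibre (fiter_pt (t v)).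
have nbr w : tree_edge (t v) w -> lvl (t' w) = 1%N /\ f.[pt (t' w)] = 0.
  rewrite -{1}(tK' w) -t_edge => -[[-> ->]|[]]; rewrite ?v0 ?ptv0 //.
have [u [lu pu]] := parent_exists Dtv.
have eu : tree_edge (t v) u by right; rewrite Dtv lu pu.
have [h Hh] : {h : algC -> vertex f & forall z, z \in ss -> lvl (h z) = m.+2 /\ pt (h z) = z}.
  apply: (@choice _ _ (fun z w => z \in ss -> lvl w = m.+2 /\ pt w = z)) => z.
  have [sz'|nz] := boolP (z \in ss); last by exists v.
  have [|w Hw] := @vertex_exists f m.+2 z; last by exists w.
  move: sz'; rewrite ms => /eqP Ez; rewrite /fiter iterSr Ez -/(fiter _ _ _).
  by rewrite -Dtv fiter_pt.
have eh z : z \in ss -> tree_edge (t v) (h z).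
  move=> sz'; have [lh ph] := Hh z sz'; left; rewrite lh ph Dtv; split=> //.
  by apply/eqP; rewrite -ms.
have t'inj w w' : tree_edge (t v) w -> tree_edge (t v) w' -> pt (t' w) = pt (t' w') -> w = w'.
  move=> /nbr[lw _] /nbr[lw' _] Ew; rewrite -(tK' w) -(tK' w'); congr t.
  by apply: vertex_eq; rewrite ?lw ?lw'.
(* [L] lists the d + 1 neighbours of [t v] pulled back by [t]: all are children of the root, which
   has only d. *)
pose L := pt (t' u) :: [seq pt (t' (h z)) | z <- ss].
suff : (size L <= size ss0)%N by rewrite /= size_map sz sz0 ltnn.
apply: uniq_leq_size => [|x].
  rewrite /= map_inj_in_uniq ?Us ?andbT.
    apply/negP=> /mapP[z sz' /(t'inj _ _ eu (eh z sz')) Eu].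
    by have [lh _] := Hh z sz'; move: lh; rewrite -Eu lu; lia.
  move=> z z' sz' sz'' /(t'inj _ _ (eh z sz') (eh z' sz'')) Ez.
  by have [_ <-] := Hh z sz'; have [_ <-] := Hh z' sz''; rewrite Ez.
rewrite ms0 inE => /predU1P[->|/mapP[z sz' ->]]; apply/eqP.
  by have [] := nbr _ eu.
by have [] := nbr _ (eh z sz').
Qed.

(** Induction on the level. A vertex [v] with parent [u] goes to a neighbour of [t u]; if this were
    the parent of [t u], it would also be the image of the parent of [u], against injectivity. *)
Lemma tree_aut_lvl (v : vertex f) : lvl (t v) = lvl v.
Proof.
have [[t' t'K tK'] t_edge] := t_aut.
have [n] := ubnP (lvl v); elim: n v => // n IH v; rewrite ltnS => le_vn.
case Dv: (lvl v) => [|m]; first exact: tree_aut_root.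
have [u [lu pu]] := parent_exists Dv.
have ltu : lvl (t u) = m by rewrite IH lu // -Dv.
have /t_edge[[-> _]|[]] : tree_edge u v by left; rewrite lu pu.
  by rewrite ltu.
rewrite ltu => Dm ptu; exfalso.
have [w [lw pw]] := parent_exists (etrans lu Dm).
have ltw : lvl (t w) = lvl (t v) by rewrite IH lw //; lia.
have /t_edge[[_ E]|[E _]] : tree_edge w u by left; rewrite lw pw lu -Dm.
  have Etwv : t w = t v by apply: vertex_eq => //; rewrite -E.
  have := congr1 t' Etwv; rewrite !t'K => Ewv.
  by move: lw; rewrite Ewv Dv; lia.
by move: E; rewrite ltw ltu; lia.
Qed.

Lemma tree_aut_parent (u v : vertex f) : lvl v = (lvl u).+1 -> f.[pt v] = pt u ->
  f.[pt (t v)] = pt (t u).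
Proof.
move=> lv pv; have [_ t_edge] := t_aut.
have /t_edge[[_ ->]//|[E _]] : tree_edge u v by left.
by move: E; rewrite !tree_aut_lvl; lia.
Qed.

End TreeAut.

(** The values nu_n(x) lie among the finitely many conjugates of [x], so they are constant on a set
    of an ultrafilter refining the eventual one; this constant is sigma(x). Each ring identity is
    read off at an index common to the sets involved. *)
Lemma limit_automorphism (nu : nat -> {rmorphism algC -> algC}) :
  exists sigma : {rmorphism algC -> algC}, forall x, forall m,
    exists2 n, (m <= n)%N & sigma x = nu n x.
Proof.
have [U [UU sub]] := ultraFilterLemma eventually_filter.
have fin x (rs : seq algC) : U [set n | nu n x \in rs]%classic ->
    exists y, U [set n | nu n x = y]%classic.
  elim: rs => [|y rs IH] Urs.
    by have [n] := filter_ex Urs; rewrite /= in_nil.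
  have [Uy|Uny] := in_ultra_setVsetC [set n | nu n x = y]%classic UU; first by exists y.
  apply: IH; apply: filterS (filterI Urs Uny) => n [/=].
  by rewrite inE => /predU1P[].
have [s Hs] : {s : algC -> algC & forall x, U [set n | nu n x = s x]%classic}.
  apply: (@choice _ _ (fun x y => U [set n | nu n x = y]%classic)) => x.
  have [rs Drs] := closed_field_poly_normal (minCpoly x).
  apply: (fin x rs); apply: filterS filterT => n _ /=.
  rewrite -root_prod_XsubC; have := root_minCpoly (nu n x).
  by rewrite minCpoly_aut Drs (monicP (minCpoly_monic x)) scale1r.
have sB : zmod_morphism s.
  move=> x y.
  have [n [/= <- [<- <-]]] := filter_ex (filterI (Hs (x - y)) (filterI (Hs x) (Hs y))).
  by rewrite rmorphB.
have sM : monoid_morphism s.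
  split=> [|x y]; first by have [n /= <-] := filter_ex (Hs 1); rewrite rmorph1.
  have [n [/= <- [<- <-]]] := filter_ex (filterI (Hs (x * y)) (filterI (Hs x) (Hs y))).
  by rewrite rmorphM.
pose saM := GRing.isZmodMorphism.Build _ _ s sB.
pose smM := GRing.isMonoidMorphism.Build _ _ s sM.
pose sigma : {rmorphism algC -> algC} := HB.pack s saM smM.
exists sigma => x m.
have Um : U [set n | (m <= n)%N]%classic by apply: sub; exists m.
by have [n [/= le_mn Dn]] := filter_ex (filterI Um (Hs x)); exists n.
Qed.

(** * The critical orbit and the levels of the tree *)

(** Otherwise halving all exponents gives a square root of [n]. *)
Lemma not_square_odd_logn (n : nat) :
  (0 < n)%N -> (forall y, n <> (y ^ 2)%N) -> exists2 q, prime q & odd (logn q n).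
Proof.
move=> n_gt0 nsq; have [/hasP[q]|/hasPn ev] := boolP (has (fun q => odd (logn q n)) (primes n)).
  by rewrite mem_primes => /and3P[pr_q _ _]; exists q.
case: (nsq (\prod_(q <- primes n) q ^ (logn q n)./2)%N).
rewrite {1}(prod_prime_decomp n_gt0) prime_decompE big_map /= expnS expn1 -big_split /=.
apply: eq_big_seq => q /ev; rewrite -expnD addnn => /negPf odd_q.
by rewrite -{1}(odd_double_half (logn q n)) odd_q.
Qed.

(* The index is shifted by one: wseq n and cseq n are w_(n+1) and c_(n+1). The
   truncated subtraction is harmless since p < (wseq p k n) ^ 2. *)
Fixpoint wseq (p k n : nat) : nat :=
  if n is m.+1 then ((k * (wseq p k m ^ 2 - p)) ^ p./2 * wseq p k m)%N
  else ((k * (p - 1)) ^ p./2)%N.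

Definition cseq (p k n : nat) : nat := (wseq p k n ^ 2 - p)%N.

Definition phiZ (p k : nat) : {poly int} :=
  'X^p + (k * p)%:R *: 'X^(p.-1) - (k * p)%:R%:P.

Definition iterZ (p k n : nat) : {poly int} := iter n (fun g => phiZ p k \Po g) 'X.

Lemma phiZC p k : pZtoC (phiZ p k) = phi_pk p k.
Proof.
rewrite /phiZ /phi_pk rmorphB rmorphD /= map_polyZ /= !map_polyXn map_polyC /=.
by rewrite !rmorph_nat.
Qed.

Lemma iterZE p k n x : (pZtoC (iterZ p k n)).[x] = fiter (phi_pk p k) n x.
Proof.
elim: n => [|n IH]; first by rewrite /= map_polyX hornerX.
by rewrite /= map_comp_poly horner_comp phiZC IH.
Qed.

Lemma iterZSr p k n : iterZ p k n.+1 = iterZ p k n \Po phiZ p k.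
Proof.
elim: n => [|n IH]; first by rewrite /iterZ /= comp_polyXr comp_polyX.
by rewrite {1}/iterZ iterS -/(iterZ p k n.+1) {1}IH comp_polyA.
Qed.

Lemma AP_horner q M (Mq : Aint_prime q M) (P : {poly int}) x y :
  x \in Aint -> y \in Aint -> M (x - y) -> M ((pZtoC P).[x] - (pZtoC P).[y]).
Proof.
move=> Ax Ay Mxy; elim/poly_ind: P => [|P c IH].
  by rewrite rmorph0 !horner0 subrr; apply: AP0 Mq.
rewrite rmorphD rmorphM /= map_polyX map_polyC !hornerMXaddC.
have -> : forall u v w : algC, u * x + w - (v * y + w) = x * (u - v) + v * (x - y) :> algC.
  by move=> u v w; ring.
by apply: (APD Mq); apply: (AP_Ml Mq) => //; apply: Aint_horner.
Qed.

Lemma prod_XsubC_rem2 (ss : seq algC) (x y : algC) :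
    x \in ss -> y \in rem x ss ->
  \prod_(z <- ss) ('X - z%:P)
    = ('X - x%:P) * ('X - y%:P) * \prod_(z <- rem y (rem x ss)) ('X - z%:P).
Proof. by move=> sx sy; rewrite (big_rem x) // (big_rem y) //= mulrA. Qed.

Lemma prod_XsubC_Aint (ss : seq algC) :
  {subset ss <= Aint} -> \prod_(z <- ss) ('X - z%:P) \is a polyOver Aint.
Proof.
move=> As; rewrite big_seq rpred_prod // => z /As Az.
by rewrite rpredB ?polyOverX ?polyOverC.
Qed.

Section TrinomialTree.

Variables p k : nat.
Hypotheses (pr_p : prime p) (p_ge3 : (3 <= p)%N) (k_gt0 : (0 < k)%N)
  (npk : ~~ (p %| k)%N).

Local Notation phi := (phi_pk p k).
Local Notation Fz := (iterZ p k).
Let a : int := - (k * (p - 1))%:Z.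

Lemma p_odd : odd p.
Proof. by case: (even_prime pr_p) p_ge3 => // ->. Qed.

Lemma half_p_gt0 : (0 < p./2)%N.
Proof. by rewrite half_gt0 ltnW. Qed.

Lemma pred_pE : p.-1 = (p./2 * 2)%N.
Proof. by rewrite -{1}(odd_double_half p) p_odd add1n /= muln2. Qed.

(** Since w >= p - 1 forces w^2 > p, the factor in the recursion is positive and the sequence never
    decreases. *)
Lemma wseq_ge n : (k * (p - 1) <= wseq p k n)%N.
Proof.
have kp_gt0 : (0 < k * (p - 1))%N by nia.
elim: n => [|n IH] /=; first by rewrite -{1}[(k * (p - 1))%N]expn1 leq_pexp2l // half_p_gt0.
have w_ge : (p - 1 <= wseq p k n)%N by apply: leq_trans IH; rewrite leq_pmull.
apply: leq_trans IH _; rewrite -{1}[wseq p k n]mul1n leq_mul2r expn_gt0 muln_gt0 k_gt0 subn_gt0.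
have -> : (p < wseq p k n ^ 2)%N by move: (wseq p k n) w_ge => w; nia.
by rewrite orbT.
Qed.

Lemma cseq_gt0 n : (0 < cseq p k n)%N.
Proof.
rewrite /cseq; have := wseq_ge n; move: (wseq _ _ _) => w kw.
have w_ge : (p - 1 <= w)%N by apply: leq_trans kw; rewrite leq_pmull.
by nia.
Qed.

Lemma wseqS n : wseq p k n.+1 = ((k * cseq p k n) ^ p./2 * wseq p k n)%N.
Proof. by []. Qed.

Lemma cseqD n : (cseq p k n + p = wseq p k n ^ 2)%N.
Proof. by have := cseq_gt0 n; rewrite /cseq; lia. Qed.

(** If w^2 = y^2 + p, then y <= w - 1 gives 2w <= p + 1, whereas w >= k(p - 1); this leaves only k =
    1 and p = 3. *)
Lemma cseq_not_square n y : ~ (p = 3 /\ k = 1)%N -> cseq p k n <> (y ^ 2)%N.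
Proof.
move=> n31 E; have := wseq_ge n; have := cseqD n; rewrite E; move: (wseq _ _ _) => w Ew kw.
have yw : (y < w)%N by nia.
have : (2 * w <= p + 1)%N by nia.
move=> w2.
have : (k * (p - 1) * 2 <= p + 1)%N by lia.
move=> h; apply: n31.
have [k1|k2] : (k = 1 \/ 2 <= k)%N by lia.
  by split => //; nia.
by nia.
Qed.

Lemma dvd_k_wseq n : (k %| wseq p k n)%N.
Proof.
have h0 := half_p_gt0; elim: n => [|n IH] /=; last exact: dvdn_mull.
by rewrite -(prednK h0) expnS -mulnA dvdn_mulr.
Qed.

Lemma dvd_cseq_wseq i n : (i < n)%N -> (cseq p k i %| wseq p k n)%N.
Proof.
have h0 := half_p_gt0; elim: n => // n IH; rewrite ltnS leq_eqVlt wseqS => /predU1P[->|/IH].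
  by rewrite -(prednK h0) expnS -!mulnA dvdn_mull // dvdn_mulr.
exact: dvdn_mull.
Qed.

Lemma p_ndvd_wseq n : ~~ (p %| wseq p k n)%N.
Proof.
elim: n => [|n IH] /=.
  rewrite Euclid_dvdX // negb_and Euclid_dvdM // negb_or npk /=.
  by rewrite gtnNdvd //; lia.
rewrite Euclid_dvdM // negb_or IH andbT Euclid_dvdX // negb_and Euclid_dvdM // negb_or npk /=.
apply/orP; left; apply: contra IH => pc.
have : (p %| wseq p k n ^ 2)%N by rewrite -cseqD dvdn_add.
by rewrite Euclid_dvdX // => /andP[].
Qed.

(** With c and w at index [n], p does not divide w, hence not c = w^2 - p; so q differs from p and
    does not divide w. But [k] and all earlier terms of [cseq] divide w. *)
Lemma cseq_prime n : ~ (p = 3 /\ k = 1)%N -> exists q,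
  [/\ prime q, odd (logn q (cseq p k n)), ~~ (q %| k)%N, ~~ (q %| p)%N
    & forall i, (i < n)%N -> ~~ (q %| cseq p k i)%N].
Proof.
move=> n31.
have [q pr_q odd_q] := not_square_odd_logn (cseq_gt0 n) (fun y => @cseq_not_square n y n31).
have qc : (q %| cseq p k n)%N.
  by apply/negPn/negP=> nqc; rewrite lognE (negPf nqc) !andbF in odd_q.
have nqp : ~~ (q %| p)%N.
  apply/negP; rewrite dvdn_prime2 // => /eqP Dq; case/negP: (p_ndvd_wseq n).
  rewrite Dq in qc; have : (p %| wseq p k n ^ 2)%N by rewrite -cseqD dvdn_add.
  by rewrite Euclid_dvdX // => /andP[].
have nqw : ~~ (q %| wseq p k n)%N.
  apply: contra nqp => qw; have : (q %| cseq p k n + p)%N by rewrite cseqD dvdn_exp.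
  by rewrite dvdn_addr.
exists q; split=> // [|i lt_in]; apply: contra nqw => h.
  exact: dvdn_trans h (dvd_k_wseq n).
exact: dvdn_trans h (dvd_cseq_wseq lt_in).
Qed.

Lemma phi_pkE (x : algC) :
  (phi_pk p k).[x] = x ^+ p.-1 * (x + (k * p)%:R) - (k * p)%:R.
Proof.
rewrite /phi_pk !hornerE; congr (_ - _).
by rewrite -{1}(prednK (prime_gt0 pr_p)) exprSr mulrDr [_ * (k * p)%:R]mulrC.
Qed.

(** As a + kp = k and p - 1 is even, [phi_pkE] gives phi(a) = k (k(p-1))^(p-1) - kp. Afterwards c +
    p = w^2 gives phi(kc) = k ((kc)^((p-1)/2) w)^2 - kp. *)
Lemma fiter_cseq n :
  fiter (phi_pk p k) n.+1 (- (k * (p - 1))%:R) = (k * cseq p k n)%:R.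
Proof.
rewrite /fiter; elim: n => [|n IH].
  rewrite /= phi_pkE pred_pE [(p./2 * 2)%N]mulnC exprM sqrrN -exprM [(2 * _)%N]mulnC exprM.
  have -> : - (k * (p - 1))%:R + (k * p)%:R = k%:R :> algC.
    by rewrite addrC -natrB; [congr _%:R | ]; nia.
  have E : (k * (wseq p k 0 ^ 2) = k * cseq p k 0 + k * p)%N by rewrite -mulnDr cseqD.
  apply/eqP; rewrite subr_eq -natrD -E /= -!natrX -natrM eqr_nat.
  by rewrite mulnC.
move: IH => /= ->; rewrite phi_pkE -natrD -mulnDr cseqD pred_pE -natrX -natrM.
apply/eqP; rewrite subr_eq -natrD -mulnDr cseqD eqr_nat wseqS expnM.
by rewrite mulnCA -expnMn.
Qed.

Lemma fiter_a n : fiter phi n.+1 a%:~R = (k * cseq p k n)%:R.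
Proof. by rewrite -fiter_cseq /a rmorphN. Qed.

Lemma fiterS_0 n : fiter (phi_pk p k) n.+1 0 = - (k * p)%:R.
Proof.
rewrite /fiter; elim: n => [|n IH]; last by rewrite iterS IH phi_pkE addNr mulr0 add0r.
rewrite /= phi_pkE.
by rewrite -(subnKC p_ge3) /= exprS !mul0r add0r.
Qed.


(** * Irreducibility and fibres of the iterates *)

Lemma size_phiZ : size (phiZ p k) = p.+1 /\ phiZ p k \is monic.
Proof.
have sz : (size (((k * p)%:R *: 'X^(p.-1) - (k * p)%:R%:P)%R : {poly int})
           < size ('X^p : {poly int}))%N.
  rewrite size_polyXn; apply: leq_ltn_trans (size_polyD _ _) _.
  rewrite gtn_max size_polyN (leq_ltn_trans (size_scale_leq _ _)) ?size_polyXn; last by lia.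
  by rewrite (leq_ltn_trans (size_polyC_leq1 _)) //; lia.
rewrite /phiZ -addrA size_polyDl // size_polyXn; split=> //.
by rewrite monicE lead_coefDl // lead_coefXn.
Qed.

Lemma size_iterZ n : size (Fz n) = (p ^ n).+1 /\ Fz n \is monic.
Proof.
have [szp mp] := size_phiZ; elim: n => [|n [szn mn]]; first by rewrite size_polyX monicX.
have szS : size (Fz n.+1) = (p ^ n.+1).+1.
  have := size_comp_poly (phiZ p k) (Fz n); rewrite szp szn /= -expnS => <-.
  rewrite prednK // lt0n size_poly_eq0 comp_poly_eq0 ?szn ?ltnS ?expn_gt0 ?prime_gt0 //.
  by rewrite -size_poly_eq0 szp.
split=> //; rewrite monicE /= lead_coef_comp ?szn ?ltnS ?expn_gt0 ?prime_gt0 //.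
by rewrite (monicP mp) (monicP mn) expr1n mulr1.
Qed.

Lemma iterZ_mod_p n : exists g : {poly int}, Fz n = 'X^(p ^ n) + p%:R * g.
Proof.
elim: n => [|n [g Dg]]; first by exists 0; rewrite mulr0 addr0.
(* [S] is the cofactor in F^p - X^(p^(n+1)) = (F - X^(p^n)) S, whose first factor is a multiple of p
   by induction. *)
set S := (\sum_(i < p) Fz n ^+ (p.-1 - i) * ('X^(p ^ n)) ^+ i).
exists (g * S + k%:R * Fz n ^+ p.-1 - k%:R).
have -> : Fz n.+1 = Fz n ^+ p + (k * p)%:R * Fz n ^+ p.-1 - (k * p)%:R.
  rewrite /= {1}/phiZ comp_polyB comp_polyD comp_polyZ !comp_Xn_poly comp_polyC.
  by rewrite -mul_polyC !rmorph_nat.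
have E : Fz n ^+ p = 'X^(p ^ n.+1) + p%:R * g * S.
  apply/eqP; rewrite addrC -subr_eq expnSr exprM subrXX -/S.
  by rewrite {1}Dg addrAC subrr add0r.
by rewrite E natrM; ring.
Qed.

(** Eisenstein at [p]: the polynomial is X^(p^n) modulo p, and its constant term phi^n(0) = -kp has
    only one factor p. Level 0 is X itself. *)
Lemma iterZ_irreducible n : irreducible_poly (pZtoQ (Fz n)).
Proof.
have [sz mon] := size_iterZ n.
case: n => [|n] in sz mon *.
  rewrite /= map_polyX; by have := irredp_XsubC (0 : rat); rewrite subr0.
apply/irreducible_rat_int; apply: (eisenstein_crit pr_p).
- by rewrite sz eqSS -lt0n expn_gt0 prime_gt0.
- by rewrite (monicP mon) dvdz1 /= gtn_eqF ?prime_gt1.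
- have -> : (Fz n.+1)`_0 = - (k * p)%:Z.
    apply: (@intr_inj algC).
    by rewrite -coef_map -horner_coef0 iterZE fiterS_0 // rmorphN.
  by rewrite dvdzE abszN -[X in ~~ X]/(p * p %| k * p)%N dvdn_pmul2r ?prime_gt0.
move=> i; rewrite sz succnK => lt_i; have [g ->] := iterZ_mod_p n.+1.
by rewrite coefD coefXn ltn_eqF // add0r mulr_natl coefMn -mulr_natl natz dvdz_mulr.
Qed.

Lemma monic_iterQ n : pZtoQ (Fz n) \is monic.
Proof. by apply: monic_map; case: (size_iterZ n). Qed.

Lemma iterQC n : pQtoC (pZtoQ (Fz n)) = pZtoC (Fz n).
Proof.
by rewrite -map_poly_comp; apply: eq_map_poly => m; rewrite /= rmorph_int.
Qed.

Lemma level_roots n : exists rs : seq algC,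
  [/\ pZtoC (Fz n) = \prod_(r <- rs) ('X - r%:P), uniq rs
    & forall x, (x \in rs) = (fiter phi n x == 0)].
Proof.
have [rs Drs Urs] := irreducible_split_uniq (monic_iterQ n) (iterZ_irreducible n).
exists rs; split=> // [|x]; first by rewrite -iterQC.
by rewrite -root_prod_XsubC -Drs iterQC rootE iterZE.
Qed.

Lemma level_Aint n x : fiter phi n x = 0 -> x \in Aint.
Proof.
move=> fx; apply: (@root_monic_Aint (pZtoC (Fz n))).
- by rewrite rootE iterZE fx.
- by apply: monic_map; case: (size_iterZ n).
- by apply/polyOverP=> i; rewrite coef_map rpred_int.
Qed.

Lemma level_conjugates n x y : fiter phi n x = 0 -> fiter phi n y = 0 ->
  exists nu : {rmorphism algC -> algC}, nu x = y.
Proof.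
by move=> fx fy; apply: (irreducible_conjugates (monic_iterQ n) (iterZ_irreducible n));
  rewrite iterQC rootE iterZE ?fx ?fy.
Qed.

Lemma fiterSr n x : fiter phi n.+1 x = fiter phi n phi.[x].
Proof. by rewrite /fiter iterSr. Qed.

(** phi - al divides phi^(n+1), whose roots are simple, so [al] has p distinct preimages. *)
Lemma level_fibre n al : fiter phi n al = 0 -> exists ss : seq algC,
  [/\ phi - al%:P = \prod_(z <- ss) ('X - z%:P), uniq ss, size ss = p
    & forall x, (x \in ss) = (phi.[x] == al)].
Proof.
move=> fal; have [rs [Drs Urs mrs]] := level_roots n.+1.
have [as_ [Das Uas mas]] := level_roots n.
have szphi : size (phi - al%:P) = p.+1 /\ phi - al%:P \is monic.
  have [sz mon] := size_phiZ.
  have sz2 : (size (- al%:P : {poly algC}) < size phi)%N.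
    rewrite size_polyN -phiZC size_map_poly_id0 ?(monicP mon) ?intr1 ?oner_eq0 // sz.
    by rewrite (leq_ltn_trans (size_polyC_leq1 _)) // ltnS prime_gt0.
  rewrite size_polyDl // monicE lead_coefDl // -phiZC.
  by rewrite size_map_poly_id0 ?(monicP mon) ?oner_eq0 // sz -monicE monic_map.
have [ss Dss] := closed_field_poly_normal (phi - al%:P).
rewrite (monicP szphi.2) scale1r in Dss; exists ss; split=> //.
- have : phi - al%:P %| pZtoC (Fz n.+1).
    rewrite iterZSr map_comp_poly phiZC Das rmorph_prod /=.
    rewrite (big_rem al) ?mas ?fal //=.
    by rewrite comp_polyB comp_polyX comp_polyC dvdp_mulr.
  rewrite Dss Drs -!separable_prod_XsubC => /dvdp_separable; apply.
  by rewrite separable_prod_XsubC.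
- by have := szphi.1; rewrite Dss size_prod_XsubC => -[].
- by move=> x; rewrite -root_prod_XsubC -Dss rootE !hornerE subr_eq0.
Qed.


Lemma phi_deriv : phi^`() = (p%:R *: 'X^(p.-2)) * ('X - a%:~R%:P).
Proof.
have [m Dp] : exists m, p = m.+3 by exists (p - 3)%N; lia.
rewrite /phi_pk /a Dp subn1 /= derivB derivC subr0 derivD derivZ !derivXn /=.
rewrite -!mul_polyC rmorphN /= -[_%:~R]/(_%:R).
rewrite polyCN !rmorph_nat !natrM ['X^(m.+2)]exprS.
by rewrite -[X in X + _ = _]mulr_natl -['X^(m.+1) *+ _]mulr_natl; ring.
Qed.

Lemma phi_derivE (x : algC) : phi^`().[x] = p%:R * x ^+ p.-2 * (x - a%:~R).
Proof. by rewrite phi_deriv !hornerE. Qed.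

Lemma phi_deriv2E : phi^`()^`().[a%:~R] = p%:R * a%:~R ^+ p.-2.
Proof.
by rewrite phi_deriv derivM derivB derivX derivC subr0 mulr1 !hornerE subrr mulr0 add0r.
Qed.

(** * Reduction modulo a prime ideal above q *)

Section PrimeAbove.

Variables (q : nat) (M : set algC).
Hypothesis Mq : Aint_prime q M.
Hypotheses (nqk : ~~ (q %| k)%N) (nqp : ~~ (q %| p)%N).

Let Aa : a%:~R \in Aint. Proof. by rewrite rpred_int. Qed.

Let nMk : ~ M k%:R. Proof. by move/(AP_nat Mq); apply/negP. Qed.
Let nMp : ~ M p%:R. Proof. by move/(AP_nat Mq); apply/negP. Qed.

Let nMkp : ~ M (k * p)%:R.
Proof. by rewrite natrM => /(AP_M Mq)[]; rewrite ?rpred_nat. Qed.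

Lemma M_fiter n x y : x \in Aint -> y \in Aint -> M (x - y) ->
  M (fiter phi n x - fiter phi n y).
Proof. by move=> Ax Ay Mxy; rewrite -!iterZE; apply: (AP_horner Mq). Qed.

(** Otherwise phi^(n+1)(x) would be congruent to phi^(n+1)(0) = -kp, which [q] does not divide. *)
Lemma fiter_notM n x : x \in Aint -> M (fiter phi n.+1 x) -> ~ M x.
Proof.
move=> Ax Mf Mx; have := @M_fiter n.+1 x 0 Ax (rpred0 _); rewrite subr0.
move=> /(_ Mx) /(AP_B Mq Mf); rewrite opprB addrCA subrr addr0 fiterS_0 //.
by move/(APN Mq); rewrite opprK.
Qed.

(** Modulo [M] the point x is a multiple root of phi - phi(x), so phi'(x) = p x^(p-2) (x - a) lies
    in [M]; neither p nor x does. *)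
Lemma critical_M n x y : fiter phi n.+1 x = 0 -> fiter phi n.+1 y = 0 ->
    phi.[x] = phi.[y] -> x != y -> M (x - y) -> M (x - a%:~R).
Proof.
move=> fx fy Exy nxy Mxy.
have Ax := level_Aint fx; have Ay := level_Aint fy.
have fal : fiter phi n phi.[x] = 0 by rewrite -fiterSr.
have [ss [Dss Uss sz mss]] := level_fibre fal.
have Ass : {subset ss <= Aint}.
  by move=> z; rewrite mss => /eqP Ez; apply: (@level_Aint n.+1); rewrite fiterSr Ez.
have sx : x \in ss by rewrite mss.
have sy : y \in rem x ss by rewrite mem_rem_uniq // inE eq_sym nxy mss Exy /=.
move: Dss; rewrite (prod_XsubC_rem2 sx sy); set G := \prod_(z <- _) _ => Dss.
have AG : G.[x] \in Aint.
  by rewrite rpred_horner // prod_XsubC_Aint // => z /mem_rem/mem_rem/Ass.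
have : phi^`().[x] = (x - y) * G.[x].
  have -> : phi^`() = (phi - phi.[x]%:P)^`() by rewrite [RHS]derivB derivC subr0.
  by rewrite Dss !derivM !derivB !derivX !derivC !hornerE; ring.
rewrite phi_derivE => E.
have : M (p%:R * x ^+ p.-2 * (x - a%:~R)) by rewrite E; apply: (AP_Mr Mq).
case/(AP_M Mq); rewrite ?rpredB ?rpredM ?rpredX ?rpred_nat //.
case/(AP_M Mq); rewrite ?rpredX ?rpred_nat // => /(AP_X Mq Ax) Mx.
by case: (@fiter_notM n x); rewrite ?fx //; apply: AP0 Mq.
Qed.

(** By induction x and y have the same image. Were they distinct, x would be congruent to a by
    [critical_M], and [M] would contain phi^(n+1)(a), that is k times [cseq p k n]. *)
Lemma level_separated n : (forall i, (i < n)%N -> ~~ (q %| cseq p k i)%N) ->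
  forall x y, fiter phi n x = 0 -> fiter phi n y = 0 -> M (x - y) -> x = y.
Proof.
elim: n => [_ x y /= -> -> //|n IH Hq x y fx fy Mxy].
have Ax := level_Aint fx; have Ay := level_Aint fy.
have Exy : phi.[x] = phi.[y].
  apply: IH => [i lt_in|||]; rewrite -?fiterSr //; first by apply: Hq; rewrite ltnW.
  exact: (@M_fiter 1).
apply/eqP/negPn/negP => nxy.
have /(M_fiter n.+1 Ax Aa) := critical_M fx fy Exy nxy Mxy.
rewrite fx sub0r => /(APN Mq).
rewrite opprK fiter_a natrM => /(AP_M Mq)[]; rewrite ?rpred_nat //.
by move/(AP_nat Mq); apply/negP/Hq.
Qed.

(** Since q divides phi^(n+1)(a), some point [al] of level n is congruent to phi(a), and a is an
    exactly double root of phi - al modulo [M]. The two roots above it are [r] and [s]. *)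
Lemma level_transposition n : (forall i, (i < n)%N -> ~~ (q %| cseq p k i)%N) ->
    odd (logn q (cseq p k n)) -> forall rs : seq algC,
    pZtoC (Fz n.+1) = \prod_(r <- rs) ('X - r%:P) -> uniq rs ->
  exists r s, [/\ r \in rs, s \in rs, r != s, phi.[r] = phi.[s] & transposes rs r s].
Proof.
move=> Hq odd_q rs Drs Urs.
have mrs x : (x \in rs) = (fiter phi n.+1 x == 0).
  by rewrite -root_prod_XsubC -Drs rootE iterZE.
have fa := fiter_a n.
have Mfa : M (fiter phi n.+1 a%:~R).
  rewrite fa natrM; apply: (AP_Ml Mq); rewrite ?rpred_nat //; apply/(AP_nat Mq).
  by apply/negPn/negP=> nq; rewrite lognE (negPf nq) !andbF in odd_q.
have nMa := fiter_notM Aa Mfa.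
have Aphi x : x \in Aint -> phi.[x] \in Aint by rewrite -phiZC; apply: Aint_horner.
have [as_ [Das Uas mas]] := level_roots n.
have Aas : {subset as_ <= Aint}.
  by move=> z; rewrite mas => /eqP Ez; apply: level_Aint Ez.
have Efa : fiter phi n.+1 a%:~R = \prod_(al <- as_) (phi.[a%:~R] - al).
  rewrite fiterSr -iterZE Das horner_prod; apply: eq_bigr => al _.
  by rewrite !hornerE.
have [al al_in Mal] : exists2 al, al \in as_ & M (phi.[a%:~R] - al).
  by apply: (AP_prod Mq); rewrite -?Efa // => z /Aas Az; rewrite rpredB ?Aphi.
have fal : fiter phi n al = 0 by apply/eqP; rewrite -mas.
have [ss [Dss Uss sz mss]] := level_fibre fal.
have ss_rs : {subset ss <= rs}.
  by move=> z; rewrite mss mrs fiterSr => /eqP ->; rewrite fal.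
have Ars : {subset rs <= Aint}.
  by move=> z; rewrite mrs => /eqP Ez; apply: level_Aint Ez.
have Ass : {subset ss <= Aint} by move=> z /ss_rs/Ars.
have derE : phi^`() = (phi - al%:P)^`() by rewrite [RHS]derivB derivC subr0.
have [r sr Mr] : exists2 r, r \in ss & M (a%:~R - r).
  apply: (AP_prod Mq); first by move=> z /Ass Az; rewrite rpredB.
  suff <- : phi.[a%:~R] - al = \prod_(i <- ss) (a%:~R - i) by [].
  have := congr1 (fun P => P.[a%:~R]) Dss; rewrite !hornerE => ->.
  by rewrite horner_prod; apply: eq_bigr => z _; rewrite !hornerE.
(* As phi'(a) = 0, the product of the a - z over the z other than r is a multiple of a - r. *)
have [s ss' Ms] : exists2 s, s \in rem r ss & M (a%:~R - s).
  apply: (AP_prod Mq); first by move=> z /mem_rem/Ass Az; rewrite rpredB.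
  have := phi_derivE a%:~R; rewrite subrr mulr0 derE Dss (big_rem r) //=.
  set G := \prod_(z <- _) _; have AG : G \is a polyOver Aint.
    by apply: prod_XsubC_Aint => z /mem_rem/Ass.
  rewrite derivM derivB derivX derivC subr0 mul1r !hornerE => /eqP.
  have -> : \prod_(i <- rem r ss) (a%:~R - i) = G.[a%:~R].
    by rewrite horner_prod; apply: eq_bigr => z _; rewrite !hornerE.
  rewrite addr_eq0 => /eqP ->; apply: (APN Mq); apply: (AP_Mr Mq) => //.
  by rewrite rpred_horner ?polyOver_deriv.
have ssS : s \in ss := mem_rem ss'.
have nrs : r != s by move: ss'; rewrite mem_rem_uniq // inE eq_sym => /andP[].
exists r, s; split; [exact: ss_rs|exact: ss_rs|by []| |].
  by have := sr; have := ssS; rewrite !mss => /eqP -> /eqP ->.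
move: Dss; rewrite (prod_XsubC_rem2 sr ss'); set G := \prod_(z <- _) _ => Dss.
have AG : G \is a polyOver Aint.
  by apply: prod_XsubC_Aint => z /mem_rem/mem_rem/Ass.
have EG : G.[a%:~R] = \prod_(z <- rem s (rem r ss)) (a%:~R - z).
  by rewrite horner_prod; apply: eq_bigr => z _; rewrite !hornerE.
(* A third root t would put phi''(a) = p a^(p-2) in [M], as each term of the second derivative keeps
   a factor a - r, a - s or a - t. *)
have notM3 t : t \in rem s (rem r ss) -> ~ M (a%:~R - t).
  move=> st Mt; have := phi_deriv2E; rewrite derE Dss /G (big_rem t) //=.
  set H := \prod_(z <- _) _; have AH : H \is a polyOver Aint.
    by apply: prod_XsubC_Aint => z /mem_rem/mem_rem/mem_rem/Ass.
  have d1 : (1 : {poly algC})^`() = 0 by rewrite -polyC1 derivC.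
  rewrite !(derivM, derivXsubC, d1, mul0r, mulr0, add0r, addr0, mul1r, mulr1, derivD).
  rewrite !hornerE /= => E.
  suff : M (p%:R * a%:~R ^+ p.-2).
    case/(AP_M Mq); rewrite ?rpredX ?rpred_nat //.
    by move/(AP_X Mq Aa).
  have {}E : (a%:~R - r) * (2%:R * H.[a%:~R] + (a%:~R - s) * (a%:~R - t) * H^`()^`().[a%:~R]
      + 2%:R * (a%:~R - s + (a%:~R - t)) * H^`().[a%:~R])
    + (a%:~R - s) * (2%:R * H.[a%:~R] + 2%:R * (a%:~R - t) * H^`().[a%:~R])
    + (a%:~R - t) * (2%:R * H.[a%:~R]) = p%:R * a%:~R ^+ p.-2.
    by rewrite -E; ring.
  have AB x : x \in ss -> a%:~R - x \in Aint by move=> /Ass Az; rewrite rpredB.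
  have [ABs ABt] := (AB s ssS, AB t (mem_rem (mem_rem st))).
  have key R S T (h0 h1 h2 : algC) : M R -> M S -> M T -> S \in Aint -> T \in Aint ->
      h0 \in Aint -> h1 \in Aint -> h2 \in Aint ->
    M (R * (2%:R * h0 + S * T * h2 + 2%:R * (S + T) * h1)
       + S * (2%:R * h0 + 2%:R * T * h1) + T * (2%:R * h0)).
    move=> MR MS MT AS AT A0 A1 A2.
    by do 2?[apply: (APD Mq)]; apply: (AP_Mr Mq); rewrite // ?(rpredD, rpredM, rpred_nat).
  by rewrite -E; apply: key; rewrite ?rpred_horner ?polyOver_deriv.
have nMG : ~ M G.[a%:~R].
  rewrite EG => /(AP_prod Mq)[z sz'|z sz' Mz]; last exact: (notM3 z).
  by rewrite rpredB // Ass // (mem_rem (mem_rem sz')).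
have al_sep al' : al' \in as_ -> M (phi.[a%:~R] - al') -> al' = al.
  rewrite mas => /eqP fal' Mal'; apply: level_separated fal' fal _ => //.
  have -> : al' - al = (phi.[a%:~R] - al) - (phi.[a%:~R] - al') by ring.
  exact: (AP_B Mq).
(* [eta] gathers the factors of phi^(n+1)(a) other than (a - r)(a - s); none lies in [M]. *)
pose eta := G.[a%:~R] * \prod_(z <- rem al as_) (phi.[a%:~R] - z).
have Aeta1 : \prod_(z <- rem al as_) (phi.[a%:~R] - z) \in Aint.
  by rewrite big_seq rpred_prod // => z /mem_rem/Aas Az; rewrite rpredB ?Aphi.
have AGa : G.[a%:~R] \in Aint by rewrite rpred_horner.
have nMeta : ~ M eta.
  case/(AP_M Mq) => // /(AP_prod Mq)[z /mem_rem/Aas Az|z]; first by rewrite rpredB ?Aphi.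
  by rewrite mem_rem_uniq // inE => /andP[nz zas] /(al_sep _ zas) Ez; rewrite Ez eqxx in nz.
have [m copm Dm] := pfactor_coprime (AP_prime Mq) (cseq_gt0 n).
have Ephi : phi.[a%:~R] - al = (a%:~R - r) * (a%:~R - s) * G.[a%:~R].
  by have := congr1 (fun P => P.[a%:~R]) Dss; rewrite !hornerE.
(* Here phi^(n+1)(a) = q^v km, with m the part of [cseq p k n] prime to q. With R = a - r and S = a
   - s, phi'(a) = 0 reads (R + S) G(a) = - R S G'(a). *)
apply: (@ramified_transposition (pZtoQ (Fz n.+1)) rs q M a r s (logn q (cseq p k n))
  (k * m)%:R eta G.[a%:~R] (- G^`().[a%:~R])) => //.
- by rewrite iterQC.
- exact: ss_rs.
- exact: ss_rs.
(* Distinct congruent roots lie in one fibre and reduce to a; so this fibre is the one over [al],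
   where only r and s reduce to a. *)
- move=> x y; rewrite !mrs => /eqP fx /eqP fy nxy Mxy.
  have Ax := level_Aint fx; have Ay := level_Aint fy.
  have Exy : phi.[x] = phi.[y].
    by apply: (level_separated Hq); rewrite -?fiterSr //; apply: (@M_fiter 1).
  have Mxa := critical_M fx fy Exy nxy Mxy.
  have Mpx : M (phi.[a%:~R] - phi.[x]).
    by rewrite -opprB; apply: (APN Mq); apply: (@M_fiter 1).
  have Ex : phi.[x] = al.
    by apply: al_sep => //; rewrite mas -fiterSr fx.
  apply/negPn/negP; rewrite negb_or => /andP[nxr nxs].
  apply: (notM3 x).
    by rewrite mem_rem_uniq ?rem_uniq // inE nxs mem_rem_uniq // inE nxr mss Ex /=.
  by rewrite -opprB; apply: (APN Mq).
- by split; rewrite ?rpred_nat ?rpredM ?rpredN ?rpred_horner ?polyOver_deriv.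
- split=> //; rewrite natrM => /(AP_M Mq)[]; rewrite ?rpred_nat //.
  by move/(AP_nat Mq); apply/negP; rewrite -prime_coprime // (AP_prime Mq).
- rewrite /eta mulrA -Ephi; transitivity ((k * cseq p k n)%:R : algC).
    by rewrite -fa Efa (big_rem al al_in) /=.
  by rewrite {1}Dm mulnA natrM natrX mulrC.
have := phi_derivE a%:~R; rewrite subrr mulr0 derE Dss.
rewrite !(derivM, derivXsubC, mul1r, mulr1) !hornerE /= => E0.
apply/eqP; rewrite mulrN -addr_eq0 -E0; apply/eqP; ring.
Qed.

End PrimeAbove.

(** * Galois realization of tree automorphisms *)

Hypothesis n31 : ~ (p = 3 /\ k = 1)%N.

Lemma phi_aut (nu : {rmorphism algC -> algC}) x : nu phi.[x] = phi.[nu x].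
Proof.
rewrite -phiZC -horner_map -map_poly_comp; congr _.[_].
by apply: eq_map_poly => m; rewrite /= rmorph_int.
Qed.

Lemma fiter_aut (nu : {rmorphism algC -> algC}) n x :
  nu (fiter phi n x) = fiter phi n (nu x).
Proof. by elim: n => //= n IH; rewrite phi_aut IH. Qed.

Lemma level_fibre_permutations n (g : algC -> algC) :
    (forall x, fiter phi n.+1 x = 0 -> phi.[g x] = phi.[x]) ->
    (forall x y, fiter phi n.+1 x = 0 -> fiter phi n.+1 y = 0 -> g x = g y -> x = y) ->
  exists nu : {rmorphism algC -> algC}, forall x, fiter phi n.+1 x = 0 -> nu x = g x.
Proof.
move=> gphi ginj; have [rs [Drs Urs mrs]] := level_roots n.+1.
have [q [pr_q odd_q nqk nqp Hq]] := cseq_prime n n31.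
have [M Mq] := Aint_prime_exists pr_q.
have rsP x : x \in rs -> fiter phi n.+1 x = 0 by rewrite mrs => /eqP.
have rs_nu (nu : {rmorphism algC -> algC}) x : (nu x \in rs) = (x \in rs).
  by rewrite !mrs -fiter_aut fmorph_eq0.
have rs_tr : {in rs &, forall x y, exists nu : {rmorphism algC -> algC}, nu x = y}.
  by move=> x y /rsP fx /rsP fy; apply: level_conjugates fx fy.
have fib : {in rs, forall x, exists ss, [/\ uniq ss, size ss = p &
     forall y, (y \in ss) = (y \in rs) && (phi.[y] == phi.[x])]}.
  move=> x /rsP fx; have fpx : fiter phi n phi.[x] = 0 by rewrite -fiterSr.
  have [ss [_ Us sz ms]] := level_fibre fpx.
  exists ss; split=> // y; rewrite ms mrs andbC.
  by case: eqP => // Ey; rewrite fiterSr Ey fpx eqxx.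
have rs_t := level_transposition Mq nqk nqp Hq odd_q Drs Urs.
have [|||nu Hnu] := fibre_permutations pr_p phi_aut rs_nu rs_tr fib rs_t (g := g).
- by move=> x /rsP fx; rewrite mrs fiterSr gphi // -fiterSr fx.
- by move=> x y /rsP fx /rsP fy; apply: ginj.
- by move=> x /rsP fx; apply: gphi.
by exists nu => x fx; apply: Hnu; rewrite mrs fx.
Qed.

(** Once [nu] agrees with [t] on level n, the inverse of [nu] composed with [t] permutes level n + 1
    inside the fibres of phi and is realized there by some [tau]; then [nu \o tau] agrees with [t]
    on level n + 1. *)
Lemma tree_aut_realized (t : vertex phi -> vertex phi) n : is_tree_aut t ->
  exists nu : {rmorphism algC -> algC}, forall v, (lvl v <= n)%N -> pt (t v) = nu (pt v).
Proof.
move=> t_aut.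
have fibre m al : fiter phi m al = 0 -> exists ss : seq algC,
    [/\ uniq ss, size ss = p & forall x, (x \in ss) = (phi.[x] == al)].
  by case/(level_fibre) => ss [_ ? ? ?]; exists ss.
have t_lvl := tree_aut_lvl fibre t_aut.
have t_par := tree_aut_parent fibre t_aut.
have t_inj : injective t by case: t_aut => /bij_inj.
(* Agreement on level m passes to smaller levels, since every vertex has a child and both maps
   commute with phi. *)
have down m (nu : {rmorphism algC -> algC}) :
    (forall v, lvl v = m -> pt (t v) = nu (pt v)) ->
    forall v, (lvl v <= m)%N -> pt (t v) = nu (pt v).
  elim: m => [|m IH] Hm v; first by rewrite leqn0 => /eqP; apply: Hm.
  rewrite leq_eqVlt => /predU1P[|]; first exact: Hm.
  apply: IH => {}v lv; have [[|x ss] [_ sz ms]] := fibre _ _ (fiter_pt v).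
    by exfalso; move: sz p_ge3 => /= <-.
  have /eqP px : phi.[x] == pt v by rewrite -ms mem_head.
  have [|c [lc pc]] := @vertex_exists phi m.+1 x; first by rewrite fiterSr px -lv fiter_pt.
  by rewrite -px phi_aut -pc -Hm // -(t_par v c) ?lc ?lv ?pc.
suff [nu Hnu] : exists nu : {rmorphism algC -> algC},
    forall v, lvl v = n -> pt (t v) = nu (pt v).
  by exists nu; apply: down.
elim: n => [|n [nu Hnu]].
  exists idfun => v v0.
  by have := fiter_pt v; have := fiter_pt (t v); rewrite t_lvl v0 => /= -> ->.
(* [V] turns a point of level n + 1 into a vertex; elsewhere its value is the root. *)
have [V HV] : {V : algC -> vertex phi & forall x, fiter phi n.+1 x = 0 ->
    lvl (V x) = n.+1 /\ pt (V x) = x}.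
  apply: (@choice _ _ (fun x v => fiter phi n.+1 x = 0 -> lvl v = n.+1 /\ pt v = x)) => x.
  have [/vertex_exists[v Hv]|nx] := pselect (fiter phi n.+1 x = 0); first by exists v.
  by have [v _] := @vertex_exists phi 0 0 erefl; exists v.
have [||tau Htau] := @level_fibre_permutations n (fun x => algC_invaut nu (pt (t (V x)))).
- move=> x fx; have [lx px] := HV x fx; have [u [lu pu]] := parent_exists lx.
  rewrite -phi_aut (t_par u (V x)) ?lx ?lu ?pu //.
  by rewrite Hnu ?lu //= algC_autK pu px.
- move=> x y fx fy /(can_inj (algC_invautK nu)) Exy.
  have [[lx <-] [ly <-]] := (HV x fx, HV y fy); congr pt; apply: t_inj.
  by apply: vertex_eq => //; rewrite !t_lvl lx ly.
exists (nu \o tau) => v lv.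
have fv : fiter phi n.+1 (pt v) = 0 by rewrite -lv fiter_pt.
rewrite /= Htau // algC_invautK; congr (pt (t _)).
by have [lx px] := HV _ fv; apply: vertex_eq; rewrite ?lx ?px.
Qed.

(** At [pt v] the limit agrees with some nu_n with n >= [lvl v], which realizes [t] there. *)
Lemma tree_aut_galois (t : vertex phi -> vertex phi) :
  is_tree_aut t -> is_galois_image t.
Proof.
move=> t_aut.
have fibre m al : fiter phi m al = 0 -> exists ss : seq algC,
    [/\ uniq ss, size ss = p & forall x, (x \in ss) = (phi.[x] == al)].
  by case/(level_fibre) => ss [_ ? ? ?]; exists ss.
have [nu Hnu] := choice (fun n => tree_aut_realized n t_aut).
have [sigma Hs] := limit_automorphism nu.
exists sigma; split.
  by exists (algC_invaut sigma); [exact: algC_autK | exact: algC_invautK].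
move=> v; split; first exact: (tree_aut_lvl fibre t_aut).
by have [n le_vn ->] := Hs (pt v) (lvl v); apply: Hnu.
Qed.

End TrinomialTree.

Theorem theorem1p3 (p k : nat) :
  prime p -> (3 <= p)%N -> (0 < k)%N -> ~~ (p %| k)%N ->
  (* the critical point a = -k(p-1) has infinite forward orbit *)
  ~ (exists s : seq algC,
       forall n, fiter (phi_pk p k) n (- ((k * (p - 1))%N%:R)) \in s) ->
  finite_index_in_aut (phi_pk p k).
Proof.
move=> pr_p p_ge3 k_gt0 npk inf_orbit.
have n31 : ~ (p = 3 /\ k = 1)%N.
  (* Here a = -2 is sent to the fixed point 1: all terms of [wseq] are 2 and all terms of [cseq] are
     1. *)
  case=> Dp Dk; subst p k; apply: inf_orbit; exists [:: - 2%:R; 1] => -[|n].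
    by rewrite mem_head.
  suff -> : fiter (phi_pk 3 1) n.+1 (- (1 * (3 - 1))%:R) = 1 by rewrite !inE eqxx orbT.
  rewrite fiter_cseq //; suff -> : cseq 3 1 n = 1%N by [].
  rewrite /cseq; suff -> : wseq 3 1 n = 2%N by [].
  by elim: n => //= n ->.
(* A single coset, represented by the identity. *)
exists 1%N, (fun _ v => v); split=> [_|t t_aut].
  by split=> //; exists id.
exists ord0, t; split=> //; exact: tree_aut_galois.
Qed.
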